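(* Let $d\in\mathbb{N}$, $\ell\in\mathbb{N}_0\cup\{\infty\}$, and let $R\subseteq\mathbb{R}^d$ be a closed, convex subset with dense interior. Assume that the restriction map $$C^\ell(\mathbb{R}^d,\mathbb{R})\to C^\ell(R,\mathbb{R}),\quad\gamma\mapsto\gamma|_R,$$ has a continuous linear right inverse. Then the restriction map $$C^\ell(\mathbb{R}^d,F)\to C^\ell(R,F),\quad\gamma\mapsto\gamma|_R,$$ has a continuous linear right inverse, for each sequentially complete locally convex space $F$.
   Context: $\mathbb{N}=\{1,2,\ldots\}$, $\mathbb{N}_0=\mathbb{N}\cup\{0\}$. ''Locally convex space'' means a real, Hausdorff locally convex topological vector space; it is sequentially complete if every Cauchy sequence converges. ''$R$ has dense interior'' means that the interior $R^0$ of $R$ in $\mathbb{R}^d$ is dense in $R$. For such $R$, $C^\ell(R,F)$ is the space of continuous maps $\gamma\colon R\to F$ such that $\gamma|_{R^0}$ is $C^\ell$ (continuous partial derivatives $\partial^\alpha$ for $|\alpha|\le\ell$) and each $\partial^\alpha(\gamma|_{R^0})$, $|\alpha|\le\ell$, extends to a (necessarily unique) continuous map $\partial^\alpha\gamma\colon R\to F$. It carries the compact-open $C^\ell$-topology: the initial topology with respect to the maps $\gamma\mapsto\partial^\alpha\gamma\in C(R,F)$, $|\alpha|\le\ell$, with the compact-open topology on $C(R,F)$. *)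

(* Defs.v *)
From HB Require Import structures.
From mathcomp Require Import all_boot all_order all_algebra.
From mathcomp Require Import all_classical all_reals all_analysis.

Set Implicit Arguments.
Unset Strict Implicit.
Unset Printing Implicit Defensive.

Import Order.TTheory GRing.Theory Num.Theory.
Import numFieldNormedType.Exports.

Local Open Scope classical_set_scope.
Local Open Scope ring_scope.

HB.mixin Record Tvs_isHausdorff (R : numDomainType) E & Tvs R E := {
  lcs_hausdorff : hausdorff_space E
}.

#[short(type="lcsType")]
HB.structure Definition LocallyConvexSpace (R : numDomainType) :=
  {E of Tvs R E & Tvs_isHausdorff R E}.

HB.instance Definition _ (R : realType) :=
  Tvs_isHausdorff.Build R R^o (@Rhausdorff R).

(* The uniform structure carried by a tvsType is not required to be
   translation invariant, so Cauchy sequences are expressed with the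
   neighbourhoods of 0 instead of the library's cauchy. *)
Definition tvs_cauchy_seq (R : numDomainType) (F : tvsType R) (u : nat -> F) :=
  forall U : set F, nbhs 0 U ->
    exists N, forall m n, (N <= m)%N -> (N <= n)%N -> U (u m - u n).

Definition sequentially_complete (R : numDomainType) (F : tvsType R) :=
  forall u : nat -> F, tvs_cauchy_seq u -> exists l : F, u @ \oo --> l.

(* None stands for the order infinity. *)
Definition ord_le (n : nat) (l : option nat) : bool :=
  if l is Some k then (n <= k)%N else true.

Definition mindex_size d (a : {ffun 'I_d -> nat}) : nat := (\sum_i a i)%N.

Section PartialDerivatives.
Context {R : realType} {d : nat} {F : lcsType R}.
Local Notation E := 'rV[R]_d.
Implicit Types (f : E -> F) (x : E) (a : {ffun 'I_d -> nat}) (l : option nat).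

(* The library's derivable and derive require a normed codomain. *)
Definition is_pderiv (i : 'I_d) f x (y : F) :=
  (fun h : R => h^-1 *: (f (x + h *: delta_mx 0 i) - f x)) @ 0^' --> y.

Definition pderivable i f x := exists y, is_pderiv i f x y.

Definition pderiv i f : E -> F := fun x => xget 0 (is_pderiv i f x).

(* d_0^(a 0) (... (d_(d-1)^(a (d-1)) f)) *)
Definition mpderiv a f : E -> F :=
  foldr (fun i => iter (a i) (pderiv i)) f (enum 'I_d).

(* Each derivative of order less than l has partial derivatives in all the
   directions, so the order of differentiation chosen in mpderiv plays no
   role. *)
Definition Cl_on l (U : set E) f :=
  (forall a i x, ord_le (mindex_size a).+1 l -> U x ->
     pderivable i (mpderiv a f) x) /\
  (forall a x, ord_le (mindex_size a) l -> U x ->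
     {for x, continuous (mpderiv a f)}).

Context {D : set E}.
Implicit Types (g : D -> F).

(* 'valL_0 g is the extension of g by 0 outside of D; only its values on the
   interior of D matter here. *)
Definition is_mpderiv_ext a g (h : D -> F) :=
  continuous h /\
  forall x : D, D° (val x) -> h x = mpderiv a ('valL_0 g) (val x).

Definition is_Cl l g :=
  [/\ continuous g, Cl_on l D° ('valL_0 g) &
      forall a, ord_le (mindex_size a) l -> exists h, is_mpderiv_ext a g h].

End PartialDerivatives.

Section PartialDerivativesTheory.
Context {R : realType} {d : nat} {F : lcsType R}.
Local Notation E := 'rV[R]_d.
Implicit Types (f g : E -> F) (x : E) (a : {ffun 'I_d -> nat}).

Lemma is_pderiv_unique i f x (y z : F) :
  is_pderiv i f x y -> is_pderiv i f x z -> y = z.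
Proof. exact/cvg_unique/lcs_hausdorff. Qed.

Lemma is_pderivE i f x y : is_pderiv i f x y -> pderiv i f x = y.
Proof. by move=> fy; apply: xget_unique => // z /is_pderiv_unique; apply. Qed.

Lemma pderivP i f x : pderivable i f x -> is_pderiv i f x (pderiv i f x).
Proof. by move=> [y fy]; rewrite (is_pderivE fy). Qed.

Lemma cvg_lin (T : Type) (G : set_system T) (FG : Filter G) (u v : T -> F)
    (c : R) (y z : F) :
  u @ G --> y -> v @ G --> z -> (fun t => c *: u t + v t) @ G --> c *: y + z.
Proof.
move=> uy vz; apply: (@continuous2_cvg _ _ _ _ _ _ _ _ +%R) => //.
  exact: (@add_continuous F (c *: y, z)).
apply: (@continuous2_cvg _ R^o F F _ _ (cst c) _ *:%R c y) => //.
  exact: (@scale_continuous _ F (c, y)).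
exact: cvg_cst.
Qed.

Lemma is_pderiv_lin i f g x (c : R) (y z : F) :
  is_pderiv i f x y -> is_pderiv i g x z ->
  is_pderiv i (c *: f + g) x (c *: y + z).
Proof.
move=> fy gz; rewrite /is_pderiv.
under eq_fun => h.
  have -> : h^-1 *: ((c *: f + g) (x + h *: delta_mx 0 i) - (c *: f + g) x) =
      c *: (h^-1 *: (f (x + h *: delta_mx 0 i) - f x)) +
      h^-1 *: (g (x + h *: delta_mx 0 i) - g x).
    rewrite !fctE !scalerBr !scalerDr !scalerA [c * _]mulrC -!scalerA.
    by rewrite opprD addrACA.
  over.
exact: cvg_lin.
Qed.

Lemma near_is_pderiv i f g x (y : F) :
  (\forall z \near x, f z = g z) -> is_pderiv i f x y -> is_pderiv i g x y.
Proof.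
move=> fg; apply: cvg_trans; apply: near_eq_cvg.
have fgx : f x = g x by exact: nbhs_singleton fg.
have cx : (fun h : R => x + h *: delta_mx 0 i) @ 0 --> x.
  have : {for 0, continuous (fun h : R => x + h *: (delta_mx 0 i : 'rV[R]_d))}.
    apply: (@continuousD _ _ _ (cst x)); first exact: cst_continuous.
    exact: scalel_continuous.
  by rewrite /prop_for /continuous_at /= scale0r addr0.
apply: cvg_within; have := cx _ fg; rewrite nbhs_nearE => {}cx.
by near=> h; rewrite fgx; congr (_ *: (_ - _)); near: h.
Unshelve. all: by end_near. Qed.

Lemma near_pderiv i f g x :
  (\forall z \near x, f z = g z) -> pderiv i f x = pderiv i g x.
Proof.
move=> fg; congr (xget 0 _); apply/seteqP; split=> y; apply: near_is_pderiv => //.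
by apply: filterS fg => z ->.
Qed.

Lemma eq_on_pderiv (U : set E) i f g : open U ->
  {in U, f =1 g} -> {in U, pderiv i f =1 pderiv i g}.
Proof.
move=> oU fg x /set_mem Ux; apply: near_pderiv.
by apply: filterS (open_nbhs_nbhs (conj oU Ux)) => z Uz; apply/fg/mem_set.
Qed.

Lemma eq_on_mpderiv (U : set E) a f g : open U ->
  {in U, f =1 g} -> {in U, mpderiv a f =1 mpderiv a g}.
Proof.
move=> oU fg; rewrite /mpderiv; elim: (enum 'I_d) => //= i s IH.
by elim: (a i) => //= n; exact: eq_on_pderiv.
Qed.

Lemma eq_on_pderivable (U : set E) i f g x : open U -> U x ->
  {in U, f =1 g} -> pderivable i f x -> pderivable i g x.
Proof.
move=> oU Ux fg [y fy]; exists y; apply: near_is_pderiv fy.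
by apply: filterS (open_nbhs_nbhs (conj oU Ux)) => z Uz; apply/fg/mem_set.
Qed.

Lemma eq_on_continuous (U : set E) f g x : open U -> U x ->
  {in U, f =1 g} -> {for x, continuous f} -> {for x, continuous g}.
Proof.
move=> oU Ux fg; rewrite /prop_for /continuous_at -(fg x (mem_set Ux)).
have fg_near : \forall z \near nbhs x, f z = g z.
  by apply: filterS (open_nbhs_nbhs (conj oU Ux)) => z Uz; apply/fg/mem_set.
by apply: cvg_trans; exact: (@near_eq_cvg _ _ (nbhs x) (nbhs_filter x) f g).
Qed.

Lemma eq_on_Cl l (U : set E) f g : open U ->
  {in U, f =1 g} -> Cl_on l U f -> Cl_on l U g.
Proof.
move=> oU fg [df cf]; split=> [a i|a] x al Ux.
  by apply: (eq_on_pderivable oU Ux (eq_on_mpderiv a oU fg)); exact: df.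
by apply: (eq_on_continuous oU Ux (eq_on_mpderiv a oU fg)); exact: cf.
Qed.

Lemma mindex_size_eq0 a f : mindex_size a = 0%N -> mpderiv a f = f.
Proof.
move=> /eqP; rewrite sum_nat_eq0 => /forallP/= a0; rewrite /mpderiv.
by elim: (enum 'I_d) => //= i s ->; rewrite (eqP (a0 i)).
Qed.

Lemma mindex_size_succ a n : mindex_size a = n.+1 ->
  exists i b, mindex_size b = n /\
    forall f, mpderiv a f = pderiv i (mpderiv b f).
Proof.
move=> an; pose b i : {ffun 'I_d -> nat} := [ffun j => (a j - (j == i))%N].
suff [i ai fE] : exists2 i, (0 < a i)%N &
    forall f, mpderiv a f = pderiv i (mpderiv (b i) f).
  exists i, (b i); split=> //; apply: succn_inj; rewrite -an /mindex_size.
  rewrite (bigD1 i)//= [in RHS](bigD1 i)//= ffunE eqxx subn1 -addSn prednK//.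
  by congr addn; apply: eq_bigr => j /negbTE ji; rewrite ffunE ji subn0.
have : (0 < \sum_(i <- enum 'I_d) a i)%N by rewrite big_enum -/(mindex_size a) an.
rewrite /mpderiv; elim: (enum 'I_d) (enum_uniq 'I_d) => [|i s IH] /=.
  by rewrite big_nil.
move=> /andP[i_s us]; rewrite big_cons.
have [ai0|ai0 _] := posnP (a i).
  rewrite ai0 add0n => /(IH us)[j aj fE]; exists j => // f.
  by rewrite ffunE ai0 sub0n /= fE.
exists i => // f; rewrite ffunE eqxx subn1 -[in LHS](prednK ai0) iterS.
congr (pderiv i (iter _ _ _)).
elim: s i_s {IH us} => //= j s IH; rewrite in_cons negb_or => /andP[ij /IH ->].
by rewrite ffunE eq_sym (negbTE ij) subn0.
Qed.

Lemma ord_leS n l : ord_le n.+1 l -> ord_le n l.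
Proof. by case: l => //= k /ltnW. Qed.

Section Linearity.
Variables (l : option nat) (U : set E) (f g : E -> F) (c : R).
Hypotheses (oU : open U) (lf : Cl_on l U f) (lg : Cl_on l U g).

Lemma mpderiv_lin a : ord_le (mindex_size a) l ->
  {in U, mpderiv a (c *: f + g) =1 c *: mpderiv a f + mpderiv a g}.
Proof.
move en : (mindex_size a) => n; elim: n a en => [|n IH] a an al.
  by rewrite !mindex_size_eq0.
have [i [b [bn bE]]] := mindex_size_succ an; rewrite !bE => x xU.
rewrite (eq_on_pderiv i oU (IH _ bn (ord_leS al)) xU).
move: xU => /set_mem xU; apply: is_pderivE; rewrite !fctE.
by apply: is_pderiv_lin; apply: pderivP; [apply: lf.1|apply: lg.1];
   rewrite ?bn.
Qed.

Lemma Cl_on_lin : Cl_on l U (c *: f + g).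
Proof.
have eqlin a (al : ord_le (mindex_size a) l) :
    {in U, c *: mpderiv a f + mpderiv a g =1 mpderiv a (c *: f + g)}.
  by move=> x xU; rewrite -mpderiv_lin.
split=> [a i|a] x al Ux.
  apply: (eq_on_pderivable oU Ux (eqlin a (ord_leS al))).
  have [y fy] := lf.1 a i x al Ux; have [z gz] := lg.1 a i x al Ux.
  by exists (c *: y + z); exact: is_pderiv_lin.
apply: (eq_on_continuous oU Ux (eqlin a al)).
by apply: (cvg_lin (nbhs_filter x)); [exact: lf.2|exact: lg.2].
Qed.

End Linearity.

Lemma is_pderiv_cst i (y : F) x : is_pderiv i (cst y) x 0.
Proof.
rewrite /is_pderiv /=; under eq_fun do rewrite subrr scaler0.
exact: cvg_cst.
Qed.

Lemma mpderiv0 a : mpderiv a (0 : E -> F) = 0.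
Proof.
rewrite /mpderiv; elim: (enum 'I_d) => //= i s ->.
elim: (a i) => //= n ->; apply/funext => x.
exact/is_pderivE/is_pderiv_cst.
Qed.

Lemma Cl_on0 l (U : set E) : Cl_on l U (0 : E -> F).
Proof.
split=> [a i|a] x _ _; rewrite mpderiv0; last exact: cst_continuous.
by exists 0; exact: is_pderiv_cst.
Qed.

End PartialDerivativesTheory.

Section Space.
Context {R : realType} {d : nat} (l : option nat) (D : set 'rV[R]_d)
  (F : lcsType R).

Definition Cl_pred : {pred D -> F} := [pred g | `[< is_Cl l g >]].

Lemma valL_val (g : D -> F) (x : D) : 'valL_0 g (val x) = g x.
Proof. exact: (congr1 (@^~ x) (valLK 0 g)). Qed.

Lemma valL_lin (c : R) (g h : D -> F) :
  {in (D° : set 'rV[R]_d), c *: 'valL_0 g + 'valL_0 h =1 'valL_0 (c *: g + h)}.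
Proof.
move=> x /set_mem /interior_subset Dx; rewrite !fctE.
by rewrite -[x]/(val (SigSub (mem_set Dx) : D)) !valL_val.
Qed.

Lemma is_Cl_lin (c : R) (g h : D -> F) :
  is_Cl l g -> is_Cl l h -> is_Cl l (c *: g + h).
Proof.
have lin_cont (u v : D -> F) : continuous u -> continuous v ->
    continuous (c *: u + v).
  by move=> cu cv x; apply: (cvg_lin (nbhs_filter x)); [exact: cu|exact: cv].
have oD := open_interior D.
move=> [cg Cg eg] [ch Ch eh]; split; first exact: lin_cont.
  exact: (eq_on_Cl oD (@valL_lin c g h) (Cl_on_lin c oD Cg Ch)).
move=> a al; have [u [cu uE]] := eg a al; have [v [cv vE]] := eh a al.
exists (c *: u + v); split=> [|x Dx]; first exact: lin_cont.
rewrite -(eq_on_mpderiv a oD (@valL_lin c g h)) ?inE//.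
by rewrite (mpderiv_lin c oD Cg Ch) ?inE// !fctE uE ?vE.
Qed.

Lemma is_Cl0 : is_Cl l (0 : D -> F).
Proof.
have oD := open_interior D.
have v0 : {in (D° : set 'rV[R]_d), (0 : _ -> F) =1 'valL_0 (0 : D -> F)}.
  move=> x /set_mem /interior_subset Dx.
  by rewrite -[x]/(val (SigSub (mem_set Dx) : D)) !valL_val.
split; first exact: cst_continuous.
  exact: eq_on_Cl v0 (Cl_on0 _ _).
move=> a _; exists 0; split=> [|x Dx]; first exact: cst_continuous.
by rewrite -(eq_on_mpderiv a oD v0) ?inE// mpderiv0.
Qed.

Lemma Cl_submod_closed : submod_closed Cl_pred.
Proof.
split=> [|c g h]; first exact/asboolP/is_Cl0.
by move=> /asboolP lg /asboolP lh; apply/asboolP/is_Cl_lin.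
Qed.

HB.instance Definition _ :=
  GRing.isSubmodClosed.Build R (D -> F) Cl_pred
    Cl_submod_closed.

Record Cl := MkCl { Cl_fun :> D -> F; _ : Cl_fun \in Cl_pred }.

HB.instance Definition _ := [isSub for Cl_fun].
HB.instance Definition _ := [Choice of Cl by <:].
HB.instance Definition _ := [SubChoice_isSubLmodule of Cl by <:].

(* The extension is unique when D has dense interior and a has size at most l,
   which is when this definition is meant to be used. *)
Definition Cl_mpderiv (a : {ffun 'I_d -> nat}) (g : Cl) : D -> F :=
  xget (fun=> 0) (is_mpderiv_ext a g).

(* Initial topology for the family of the maps Cl_mpderiv a. *)
Definition Cl_topology := sup_topology
  (fun a : {a : {ffun 'I_d -> nat} | ord_le (mindex_size a) l} =>
    Topological.class (initial_topology
      (Cl_mpderiv (val a) : Cl -> {compact-open, D -> F}))).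

HB.instance Definition _ := Topological.copy Cl Cl_topology.

End Space.

Section Restriction.
Context {R : realType} {d : nat} (l : option nat) (D : set 'rV[R]_d)
  (F : lcsType R).
Local Notation E := 'rV[R]_d.

Definition restr_fun (g : [set: E] -> F) : D -> F :=
  fun x => g (to_setT (val x)).

Lemma is_Cl_restr (g : [set: E] -> F) : is_Cl l g -> is_Cl l (restr_fun g).
Proof.
have oD := open_interior D.
have r_cont (h : [set: E] -> F) : continuous h -> continuous (restr_fun h).
  have ct : continuous (fun x : D => to_setT (val x)).
    by apply: continuous_comp_initial => y; exact: initial_continuous.
  by move=> ch x; exact: continuous_comp (ct x) (ch _).
have rE : {in (D° : set E), 'valL_0 g =1 'valL_0 (restr_fun g)}.
  move=> x /set_mem /interior_subset Dx.
  rewrite -[RHS]/('valL_0 (restr_fun g) (val (SigSub (mem_set Dx) : D))).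
  by rewrite valL_val /restr_fun -valL_val.
move=> [cg [dg dcg] eg]; split; first exact: r_cont.
  apply: (eq_on_Cl oD rE); split=> [a i|a] x al _.
    by apply: dg => //; rewrite interiorT.
  by apply: dcg => //; rewrite interiorT.
move=> a al; have [h [ch hE]] := eg a al.
exists (restr_fun h); split=> [|x Dx]; first exact: r_cont.
rewrite -(eq_on_mpderiv a oD rE) ?inE// /restr_fun hE//.
by rewrite interiorT.
Qed.

Lemma Cl_restr_subproof (g : Cl l [set: E] F) :
  restr_fun g \in @Cl_pred R d l D F.
Proof. by apply/asboolP/is_Cl_restr/asboolP; exact: (valP g). Qed.

Definition Cl_restr (g : Cl l [set: E] F) : Cl l D F :=
  MkCl (Cl_restr_subproof g).

End Restriction.

Definition continuous_linear_right_inverse (R : realType)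
    (V W : preTopologicalLmodType R) (r : V -> W) : Prop :=
  exists e : {linear W -> V}, continuous e /\ cancel e r.

(* Main.v *)
Require Import Defs.
From HB Require Import structures.
From mathcomp Require Import all_boot all_order all_algebra.
From mathcomp Require Import all_classical all_reals all_analysis.
From mathcomp Require Import ring lra zify.

(** Write e for the scalar extension operator. For fixed x and a, the functional
    f |-> d^a (e f) (x) is bounded by C times the supremum over a compact set K
    of finitely many derivatives d^b f. By Hahn-Banach it extends to bounded
    functions of (b, z), where it can be applied to functions with finitely many
    values; hence, approximating the jet (d^b g (z))_(b, z) of a vector-valued g
    uniformly by step functions, one gets a Cauchy sequence in F. Its limit
    G_a(x) satisfies lam (G_a(x)) = d^a (e (lam o g)) (x) for every continuous
    linear form lam. As such forms separate points, G_a(x) is unique and linear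
    in g, and the polars of the neighbourhoods of 0 transfer the estimates for
    e: G_a is continuous (the compositions lam o g, for lam in a polar, form a
    totally bounded set of functions), and the mean value theorem gives
    d_i G_a = G_(a + e_i). Thus g |-> G_0 is the required right inverse. *)

Set Implicit Arguments.
Unset Strict Implicit.
Unset Printing Implicit Defensive.

Import Order.TTheory GRing.Theory Num.Theory.
Import numFieldNormedType.Exports.

Local Open Scope classical_set_scope.
Local Open Scope ring_scope.

(** * The Hahn-Banach theorem *)

(** Gives functions that are only known to be linear access to the theory of bundled linear maps. *)
Lemma linear_bundle (R : pzRingType) (U V : lmodType R) (f : U -> V) :
  linear f -> exists g : {linear U -> V}, g =1 f.
Proof.
move=> lf.
pose g : {linear U -> V} := HB.pack f (GRing.isLinear.Build R U V *:%R f lf).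
by exists g.
Qed.

Section HahnBanach.
Context {R : realType} {V : lmodType R}.
Implicit Types (G : set (V * R)) (W : set V) (p : V -> R).

(** A partial functional is represented by its graph, so that Zorn's lemma applies to inclusion of
    sets. Single-valuedness comes from domination: [(v, r)] and [(v, s)] yield [(0, r - s)], hence
    [r - s <= p 0 = 0]. *)
Definition linear_graph G := forall c x r y s,
  G (x, r) -> G (y, s) -> G (c *: x + y, c * r + s).

Definition dominated p G := forall x r, G (x, r) -> r <= p x.

Definition sublinear p :=
  (forall x y, p (x + y) <= p x + p y) /\
  (forall t x, 0 < t -> p (t *: x) = t * p x).

(** A value [a] at [v] must satisfy [r - p (x - v) <= a <= p (y + v) - s] for all [(x, r)] and
    [(y, s)] in [G]. Subadditivity puts every lower bound below every upper bound, so the supremum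
    of the lower bounds will do. *)
Lemma dominated_extend1 p G v :
  sublinear p -> linear_graph G -> G (0, 0) -> dominated p G ->
  exists G', [/\ linear_graph G', dominated p G', G `<=` G' &
    exists a, G' (v, a)].
Proof.
move=> [pD pZ] lG G0 dG.
pose T := [set z | exists x r, G (x, r) /\ z = r - p (x - v)].
have TB x r y s : G (x, r) -> G (y, s) -> r - p (x - v) <= p (y + v) - s.
  move=> Gx Gy; have := dG _ _ (lG 1 _ _ _ _ Gx Gy).
  rewrite scale1r mul1r => le1; have := pD (x - v) (y + v).
  rewrite addrACA [- v + v]addrC subrr addr0; lra.
have T0 : T !=set0 by exists (0 - p (0 - v)), 0, 0.
have supT : has_sup T.
  split=> //; exists (p (0 + v) - 0) => z [x [r [Gx ->]]].
  exact: TB Gx G0.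
pose a := sup T.
have aub x r : G (x, r) -> r - p (x - v) <= a.
  by move=> Gx; apply: (sup_upper_bound supT); exists x, r.
have alb y s : G (y, s) -> a <= p (y + v) - s.
  by move=> Gy; apply: ge_sup => // z [x [r [Gx ->]]]; exact: TB Gx Gy.
have G_scale t x r : G (x, r) -> G (t *: x, t * r).
  by move=> Gx; have := lG t _ _ _ _ Gx G0; rewrite !addr0.
exists [set z | exists x r t, G (x, r) /\ z = (x + t *: v, r + t * a)].
split.
- move=> c _ _ _ _ [x [r [t [Gx [-> ->]]]]] [y [s [u [Gy [-> ->]]]]].
  exists (c *: x + y), (c * r + s), (c * t + u); split; first exact: lG.
  rewrite scalerDr scalerDl scalerA addrACA; congr (_, _); ring.
- move=> _ _ [x [r [t [Gx [-> ->]]]]].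
  (* Dividing by [|t|] reduces negative [t] to the lower bounds for [a] and positive [t] to the
     upper ones. *)
  have [t0|t0|->] := ltgtP t 0; last by rewrite scale0r mul0r !addr0; exact: dG.
  + have := aub _ _ (G_scale (- t)^-1 _ _ Gx).
    have nt0 : 0 < - t by rewrite oppr_gt0.
    have -> : (- t)^-1 *: x - v = (- t)^-1 *: (x + t *: v).
      by rewrite scalerDr scalerA invrN mulNr mulVf ?lt_eqF// scaleN1r.
    rewrite pZ ?invr_gt0// -mulrBr ler_pdivrMl//; lra.
  + have := alb _ _ (G_scale t^-1 _ _ Gx).
    have -> : t^-1 *: x + v = t^-1 *: (x + t *: v).
      by rewrite scalerDr scalerA mulVf ?gt_eqF// scale1r.
    rewrite pZ ?invr_gt0// -mulrBr ler_pdivlMl//; lra.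
- move=> [x r] Gx; exists x, r, 0; split=> //.
  by rewrite scale0r mul0r !addr0.
- by exists a, 0, 0, 1; split=> //; rewrite scale1r mul1r !add0r.
Qed.

Theorem hahn_banach p G :
  sublinear p -> linear_graph G -> G (0, 0) -> dominated p G ->
  exists lam : {linear V -> R^o},
    (forall x, lam x <= p x) /\ forall x r, G (x, r) -> lam x = r.
Proof.
move=> sp lG G0 dG.
pose P := [set A | [/\ linear_graph A, dominated p A & A = set0 \/ G `<=` A]].
have [F FP totF|A [[lA dA A0] maxA]] := @Zorn_bigcup _ P.
  split.
  - move=> c x r y s [X FX Xx] [Y FY Yy].
    have [XY|YX] := totF _ _ FX FY.
      by exists Y => //; have [lY _ _] := FP _ FY; apply: lY => //; exact: XY.
    by exists X => //; have [lX _ _] := FP _ FX; apply: lX => //; exact: YX.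
  - by move=> x r [X FX]; have [_ dX _] := FP _ FX; exact: dX.
  - have [[X FX [z Xz]]|no] := pselect (exists2 X, F X & X !=set0).
      right; have [_ _ [X0|GX]] := FP _ FX; first by rewrite X0 in Xz.
      by move=> w Gw; exists X => //; exact: GX.
    left; rewrite -subset0 => z [X FX Xz]; apply: no.
    by exists X => //; exists z.
have GA : G `<=` A.
  case: A0 => // A0; exfalso; apply: (maxA G); last by split=> //; right.
  by rewrite A0; split=> [[]//|/(_ _ G0)].
(* By maximality the extension to [v] stays inside [A], so [A] is defined everywhere. *)
have tot v : exists r, A (v, r).
  have [G' [lG' dG' AG' [a G'a]]] := dominated_extend1 v sp lA (GA _ G0) dA.
  exists a; apply: contrapT => nAa; apply: (maxA G').
    by split=> // /(_ _ G'a).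
  by split=> //; right; apply: subset_trans AG'.
have p0 : p 0 = 0.
  have := sp.2 2 0 ltac:(lra); rewrite scaler0; lra.
have uniqA v r s : A (v, r) -> A (v, s) -> r = s.
  suff le r' s' : A (v, r') -> A (v, s') -> r' <= s'.
    by move=> Ar As; apply/eqP; rewrite eq_le !le.
  move=> Ar As; have := dA _ _ (lA (-1) _ _ _ _ As Ar).
  by rewrite scaleN1r addNr p0; lra.
have [lam lamP] := choice tot.
have llam : linear (lam : V -> R^o).
  by move=> c x y; apply: (uniqA (c *: x + y)) => //; exact: lA.
have [L LE] := linear_bundle llam.
exists L; split=> [x|x r Gx]; rewrite LE; first exact: dA.
exact: (uniqA x) (GA _ Gx).
Qed.

(** * Absolutely convex sets, gauges and polars *)

Definition disked W := forall x y s t,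
  W x -> W y -> `|s| + `|t| <= 1 -> W (s *: x + t *: y).

Definition absorbing W := forall x, exists2 t, 0 < t & W (t *: x).

Definition polar W (lam : V -> R) := forall x, W x -> `|lam x| <= 1.

Lemma disked_scale W x s : disked W -> W x -> `|s| <= 1 -> W (s *: x).
Proof.
move=> dW Wx s1; rewrite -[_ *: _]addr0 -(scale0r x).
by apply: dW; rewrite ?normr0 ?addr0.
Qed.

(* The functional is dominated by the gauge of W. *)
Lemma polar_extension W G : disked W -> absorbing W ->
  linear_graph G -> G (0, 0) -> (forall x r, G (x, r) -> W x -> r <= 1) ->
  exists lam : {linear V -> R^o},
    polar W lam /\ forall x r, G (x, r) -> lam x = r.
Proof.
move=> dW aW lG G0 GW.
(* [S x] consists of the [t > 0] with [x] in [t W]; its infimum [p x] is the Minkowski gauge. *)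
pose S x := [set t : R | 0 < t /\ W (t^-1 *: x)].
have S0 x : S x !=set0.
  have [t t0 Wt] := aW x; exists t^-1; split; first by rewrite invr_gt0.
  by rewrite invrK.
have lbS x : lbound (S x) 0 by move=> t [/ltW].
pose p x := inf (S x).
have pS x t : S x t -> p x <= t by move=> Sxt; apply: ge_inf Sxt; exists 0.
have leP x c : (forall t, S x t -> c <= t) -> c <= p x.
  by move=> cS; apply: lb_le_inf => // t /cS.
have pW x : W x -> p x <= 1.
  by move=> Wx; apply: (pS _ _); split=> //; rewrite invr1 scale1r.
have SD x y s t : S x s -> S y t -> S (x + y) (s + t).
  move=> [s0 Ws] [t0 Wt]; have st0 : 0 < s + t by rewrite addr_gt0.
  split=> //.
  have -> : (s + t)^-1 *: (x + y) =
      (s / (s + t)) *: (s^-1 *: x) + (t / (s + t)) *: (t^-1 *: y).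
    by rewrite !scalerA scalerDr; congr (_ *: _ + _ *: _); field; lra.
  by apply: dW => //; rewrite !ger0_norm ?divr_ge0 ?(ltW s0, ltW t0, ltW st0)//
    -mulrDl divff ?gt_eqF.
have SZ x (s t : R) : 0 < s -> S x t -> S (s *: x) (s * t).
  move=> s0 [t0 Wt]; split; first by rewrite mulr_gt0.
  by rewrite scalerA (_ : (s * t)^-1 * s = t^-1)//; field; lra.
have sp : sublinear p.
  split=> [x y|].
    rewrite -lerBlDr; apply: (leP _ _) => s Ss; rewrite lerBlDr -lerBlDl.
    by apply: (leP _ _) => t St; rewrite lerBlDl; apply: (pS _ _); exact: SD.
  suff pZ t x : 0 < t -> p (t *: x) <= t * p x.
    move=> t x t0; apply/eqP; rewrite eq_le pZ//= -ler_pdivlMl//.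
    have ti0 : 0 < t^-1 by rewrite invr_gt0.
    apply: le_trans (pZ _ (t *: x) ti0).
    by rewrite scalerA mulVf ?gt_eqF// scale1r.
  move=> t0; rewrite -ler_pdivrMl//; apply: (leP _ _) => s Ss.
  by rewrite ler_pdivrMl//; apply: (pS _ _); exact: SZ.
have dG : dominated p G.
  move=> x r Gx; apply: (leP _ _) => t [t0 Wt].
  have := lG t^-1 _ _ _ _ Gx G0; rewrite !addr0 => /GW/(_ Wt).
  by rewrite ler_pdivrMl// mulr1.
have [lam [lamp lamG]] := hahn_banach sp lG G0 dG.
exists lam; split=> // x Wx; rewrite ler_norml; apply/andP; split.
  rewrite lerNl -[leLHS](linearN lam); apply: le_trans (lamp _) (pW _ _).
  by rewrite -scaleN1r; apply: disked_scale; rewrite ?normrN1.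
exact: le_trans (lamp _) (pW _ Wx).
Qed.

(** The form [t y |-> t] on the line through [y] is at most 1 on [W]: if [t y] were in [W] with
    [t > 1], then so would be its contraction [y]. This form is then extended. *)
Lemma polar_separation W y : disked W -> absorbing W -> ~ W y ->
  exists lam : {linear V -> R^o}, polar W lam /\ lam y = 1.
Proof.
move=> dW aW nWy.
have W0 : W 0.
  by have [t _ Wt] := aW 0; rewrite scaler0 in Wt.
pose G := [set z | exists t, z = (t *: y, t)].
have lG : linear_graph G.
  move=> c _ _ _ _ [t [-> ->]] [u [-> ->]]; exists (c * t + u).
  by rewrite scalerDl scalerA.
have G0 : G (0, 0) by exists 0; rewrite scale0r.
have [_ r [t [-> ->]] Wt|lam [plam lamG]] := polar_extension dW aW lG G0.
  rewrite leNgt; apply/negP => t1; apply: nWy.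
  rewrite -[y]scale1r -(@mulVf _ t) ?gt_eqF ?(lt_trans _ t1)// -scalerA.
  apply: disked_scale => //; rewrite ger0_norm ?invr_ge0; last by lra.
  by rewrite invf_le1; lra.
by exists lam; split=> //; apply: lamG; exists 1; rewrite scale1r.
Qed.

(** One half of the bipolar theorem. The strict inequality replaces closedness of [W], as the
    separating form takes exactly the value 1 at [y]. *)
Lemma in_polar W y : disked W -> absorbing W ->
  (forall lam : {linear V -> R^o}, polar W lam -> `|lam y| < 1) -> W y.
Proof.
move=> dW aW lt1; apply: contrapT => /(polar_separation dW aW)[lam [plam lam1]].
by have := lt1 _ plam; rewrite lam1 normr1 ltxx.
Qed.

End HahnBanach.

(** * Weak integrals in locally convex spaces *)

Section TopologicalVectorSpaces.
Context {R : realType} {F : tvsType R}.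
Implicit Types (U W : set F) (x y : F).

Lemma nbhs0_scale U (c : R) : nbhs 0 U -> nbhs 0 [set x | U (c *: x)].
Proof.
move=> U0.
have /= := @scale_continuous R F (c, 0) U; rewrite scaler0 => /(_ U0)[]/= B.
move=> [B1 B2] BU; apply: filterS B2 => y By.
by apply: (BU (c, y)); split => //; exact: (@nbhs_singleton R^o).
Qed.

Lemma nbhs0_shift U x : nbhs 0 U -> nbhs x [set y | U (y - x)].
Proof.
move=> U0; apply: filterS (nbhsT x U0) => _ [z Uz <-] /=.
by rewrite addrAC subrr add0r.
Qed.

Lemma nbhs_shift0 U x : nbhs x U -> nbhs 0 [set y | U (x + y)].
Proof.
move=> Ux; have := nbhsB (- x) Ux; rewrite addNr.
by apply: filterS => _ [z Uz <-] /=; rewrite addrA subrr add0r.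
Qed.

Lemma nbhs0_absorbing U : nbhs 0 U -> absorbing U.
Proof.
move=> U0 x.
have /= := @scale_continuous R F (0, x) U; rewrite scale0r => /(_ U0)[]/= B.
move=> [/nbhs_ballP[e /= e0 eB] B2] BU; exists (e / 2); first by rewrite divr_gt0.
apply: (BU (e / 2, x)); split => /=; last exact: nbhs_singleton B2.
by apply: eB; rewrite /ball /= sub0r normrN gtr0_norm ?divr_gt0//; lra.
Qed.

Lemma nbhs0_disked U : nbhs 0 U -> exists W, [/\ nbhs 0 W, disked W & W `<=` U].
Proof.
move=> U0; have [B convB [oB basB]] := @locally_convex R F.
have [b [Bb b0] bU] := basB 0 _ U0.
have nb0 : nbhs 0 b by apply: open_nbhs_nbhs; split=> //; exact: oB.
have cb x y (k : R) : 0 <= k -> k <= 1 -> b x -> b y -> b (k *: x + (1 - k) *: y).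
  move=> k0 k1 bx bY; apply/set_mem.
  exact: (convB b (mem_set Bb) x y (Itv01 k0 k1) (mem_set bx) (mem_set bY)).
(* Intersecting the convex set [b] with its reflection gives a symmetric convex set, so that signs
   of coefficients can be moved to the points. *)
pose W := b `&` (-%R @` b).
have WN x : W x -> W (- x).
  by move=> [bx [z bz zx]]; split; [rewrite -zx opprK|exists x].
have Wb x (s : R) : W x -> exists x', s *: x = `|s| *: x' /\ b x'.
  move=> Wx; have [s0|s0] := leP 0 s.
    by exists x; rewrite ger0_norm//; split=> //; case: Wx.
  exists (- x); rewrite ltr0_norm// scalerN scaleNr opprK; split=> //.
  by have [] := WN _ Wx.
have bst x y (s t : R) : W x -> W y -> `|s| + `|t| <= 1 -> b (s *: x + t *: y).
  move=> Wx Wy st; have [x' [-> bx]] := Wb x s Wx; have [y' [-> bY]] := Wb y t Wy.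
  have [s0 t0] : 0 <= `|s| /\ 0 <= `|t| by [].
  have [t1|t1] := eqVneq `|s| 1.
    have -> : `|t| = 0 by lra.
    by rewrite t1 scale1r scale0r addr0.
  have s1 : 0 < 1 - `|s| by rewrite subr_gt0 lt_neqAle t1; lra.
  (* The sum becomes a convex combination of [x'] and a point obtained by shrinking [y'] towards 0
     by the factor [|t| / (1 - |s|) <= 1]. *)
  have -> : `|t| *: y' = (1 - `|s|) *: ((`|t| / (1 - `|s|)) *: y' +
      (1 - `|t| / (1 - `|s|)) *: 0).
    by rewrite scaler0 addr0 scalerA mulrC divfK ?gt_eqF.
  apply: (cb _ _ _) => //; first lra.
  apply: (cb _ _ _) => //; first by rewrite divr_ge0// ltW.
  by rewrite ler_pdivrMr// mul1r; lra.
exists W; split; first by apply: filterI => //; exact: nbhs0N.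
  move=> x y s t Wx Wy st; split; first exact: bst.
  exists (- (s *: x + t *: y)); last by rewrite opprK.
  by rewrite opprD -!scalerN; apply: bst => //; exact: WN.
by move=> x [bx _]; exact: bU.
Qed.

Lemma polar_continuous U (lam : {linear F -> R^o}) :
  nbhs 0 U -> polar U lam -> continuous lam.
Proof.
move=> U0 plam x; apply/cvgrPdist_le => /= e e0.
have := nbhs0_shift x (nbhs0_scale e^-1 U0); apply: filterS => y /= /plam.
rewrite linearZ/= normrM gtr0_norm ?invr_gt0// ler_pdivrMl// mulr1.
by rewrite linearB/= distrC.
Qed.

Lemma polar_scale U (lam : {linear F -> R^o}) (e : R) x :
  0 < e -> polar U lam -> U (e^-1 *: x) -> `|lam x| <= e.
Proof.
move=> e0 plam /plam; rewrite linearZ/= normrM gtr0_norm ?invr_gt0//.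
by rewrite ler_pdivrMl// mulr1.
Qed.

Lemma continuous_polar (lam : {linear F -> R^o}) : continuous lam ->
  exists W, [/\ nbhs 0 W, disked W & polar W lam].
Proof.
move=> clam; exists [set x | `|lam x| <= 1]; split=> //.
  have := clam 0; rewrite /continuous_at linear0 => /cvgrPdist_le/(_ 1 ltr01).
  by apply: filterS => x /=; rewrite sub0r normrN.
move=> x y s t /= lx ly st; rewrite linearD !linearZ/=.
apply: le_trans (ler_normD _ _) _; rewrite !normrM; apply: le_trans st.
by apply: lerD; rewrite ler_piMr.
Qed.

(** The transfer principle of the proof: scalar estimates for the continuous forms in the polar of
    [W] become membership in [W]. *)
Lemma in_nbhs_polar W y : nbhs 0 W -> disked W ->
  (forall lam : {linear F -> R^o}, continuous lam -> polar W lam -> `|lam y| < 1) ->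
  W y.
Proof.
move=> W0 dW lt1; apply: in_polar dW (nbhs0_absorbing W0) _ => lam plam.
by apply: lt1 => //; exact: polar_continuous W0 plam.
Qed.

End TopologicalVectorSpaces.

(** All continuous forms vanish at [y - x], so it lies in every disked neighbourhood of 0. Thus
    every neighbourhood of [x] contains [y], and [F] is Hausdorff. *)
Lemma eq_by_dual (R : realType) (F : lcsType R) (x y : F) :
  (forall lam : {linear F -> R^o}, continuous lam -> lam x = lam y) -> x = y.
Proof.
move=> xy; apply: lcs_hausdorff => A B nA nB.
have nxA := nbhs_shift0 nA.
have [W [W0 dW WA]] := nbhs0_disked nxA.
exists y; split; last exact: nbhs_singleton nB.
have /WA/= : W (y - x).
  apply: in_nbhs_polar => // lam /xy E _.
  by rewrite linearB/= E subrr normr0.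
by rewrite addrC subrK.
Qed.

Section WeakIntegral.
Context {R : realType} {V : lmodType R} {A : Type} (S : set A) (J : A -> V -> R)
  (T : {linear V -> R^o}) (C : R).
Hypotheses (C_gt0 : 0 < C) (J_linear : forall a, S a -> linear (J a : V -> R^o))
  (J_bounded : forall f, exists M : R, forall a, S a -> `|J a f| <= M)
  (T_bounded : forall f, (forall a, S a -> `|J a f| <= 1) -> `|T f| <= C).

(* T is extended to the pairs (f, t), seen as the functions
   a |-> J a f - t (c a) on S, with the sup norm. *)
Lemma quadrature (I : finType) (c : A -> I) :
  exists tau : I -> R, forall f (t : I -> R),
    (forall a, S a -> `|J a f - t (c a)| <= 1) ->
    `|T f - \sum_i tau i * t i| <= C.
Proof.
pose X := (V * (I -> R^o))%type.
pose U : set X := [set z | forall a, S a -> `|J a z.1 - z.2 (c a)| <= 1].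
have JE a : S a -> forall k f g, J a (k *: f + g) = k * J a f + J a g.
  by move=> Sa k f g; rewrite (J_linear Sa).
have JZ a : S a -> forall k f, J a (k *: f) = k * J a f.
  by move=> Sa k f; have [j jE] := linear_bundle (J_linear Sa); rewrite -!jE linearZ.
have dU : disked U.
  move=> z w s t Uz Uw st a Sa /=; rewrite JE// JZ// !fctE.
  have -> : s * J a z.1 + t * J a w.1 - (s *: z.2 (c a) + t *: w.2 (c a)) =
    s * (J a z.1 - z.2 (c a)) + t * (J a w.1 - w.2 (c a)) by rewrite /GRing.scale/=; ring.
  apply: le_trans (ler_normD _ _) _; rewrite !normrM; apply: le_trans st.
  by apply: lerD; rewrite ler_piMr//; [exact: Uz|exact: Uw].
have aU : absorbing U.
  move=> [f t]; have [M JM] := J_bounded f.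
  pose B := \sum_i `|t i|.
  have B0 : 0 <= B by apply: sumr_ge0.
  have tB i : `|t i| <= B by rewrite /B (bigD1 i)//= lerDl sumr_ge0.
  (* [N] bounds the sup norm of the function encoded by [(f, t)]; the summand 1 makes it
     positive. *)
  pose N := `|M| + B + 1; have N0 : 0 < N by have := normr_ge0 M; rewrite /N; lra.
  exists N^-1; first by rewrite invr_gt0.
  move=> a Sa /=; rewrite JZ// !fctE -[_ *: _]/(N^-1 * t (c a)) -mulrBr normrM.
  rewrite gtr0_norm ?invr_gt0// ler_pdivrMl// mulr1.
  apply: le_trans (ler_normB _ _) _.
  by have := JM _ Sa; have := tB (c a); have := ler_norm M; rewrite /N; lra.
(* The functional to be extended is [T / C] on the pairs [(f, 0)], at most 1 on the unit ball [U] by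
   [T_bounded]. *)
pose G : set (X * R) := [set z | exists f, z = ((f, 0), C^-1 * T f)].
have lG : linear_graph G.
  move=> k _ _ _ _ [f [-> ->]] [g [-> ->]]; exists (k *: f + g).
  rewrite linearD linearZ/= -[_ *: T f]/(k * T f); congr (_, _); last by ring.
  congr (_, _); apply/funext => i; rewrite /= !fctE.
  by rewrite scaler0 addr0.
have G0 : G (0, 0) by exists 0; rewrite linear0 mulr0.
have [_ _ [f [-> ->]] Uf|lam [plam lamG]] := polar_extension dU aU lG G0.
  rewrite ler_pdivrMl// mulr1; apply: le_trans (ler_norm _) _.
  by apply: T_bounded => a Sa; rewrite -[J a f]subr0; exact: Uf.
pose d i : X := (0, fun j => (j == i)%:R : R^o).
(* Step functions enter [(f, t)] with a minus sign, and [C] undoes the normalization: the quadrature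
   error is [C * lam (f, t)]. *)
exists (fun i => - C * lam (d i)) => f t ft.
have E : (f, t) = (f, 0) + \sum_i t i *: d i :> X.
  apply: injective_projections => /=.
    by rewrite (raddf_sum fst)/= big1 ?addr0// => i _; rewrite scaler0.
  rewrite add0r (raddf_sum snd)/=; apply/funext => j; rewrite fct_sumE.
  rewrite (bigD1 j)//= !fctE eqxx big1 ?addr0 => [|i /negbTE ij].
    by rewrite /GRing.scale/= mulr1.
  by rewrite !fctE eq_sym ij scaler0.
have : U (f, t) by exact: ft.
move=> /plam; rewrite E linearD (lamG _ (C^-1 * T f)); last by exists f.
rewrite linear_sum/= => le1.
have -> : T f - \sum_i - C * lam (d i) * t i =
    C * (C^-1 * T f + \sum_i lam (t i *: d i)).
  rewrite mulrDr mulVKf ?gt_eqF//; congr (_ + _); rewrite mulr_sumr -sumrN.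
  apply: eq_bigr => i _.
  have -> : lam (t i *: d i) = t i * lam (d i) by exact: (linearZZ lam).
  by rewrite !mulNr opprK -mulrA; congr (_ * _); exact: mulrC.
by rewrite normrM gtr0_norm// ler_piMr// ltW.
Qed.

Context {F : lcsType R} (Gam : A -> F).
Hypotheses (F_complete : sequentially_complete F)
  (dual_comp : forall lam : {linear F -> R^o}, continuous lam ->
     exists f, forall a, S a -> J a f = lam (Gam a)).
Context (I : nat -> finType) (c : forall n, A -> I n) (v : forall n, I n -> F).
Hypothesis Gam_step : forall W, nbhs 0 W ->
  \forall n \near \oo, forall a, S a -> W (Gam a - v (c n a)).

(** [y] is a weak integral of [Gam] with respect to [T]: the limit of the quadrature sums of the
    approximating step functions. The weights at stage [n] are the same for all forms [lam]. *)
Lemma weak_integral : exists y, forall (lam : {linear F -> R^o}) f,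
  continuous lam -> (forall a, S a -> J a f = lam (Gam a)) -> T f = lam y.
Proof.
have [tau tauP] : exists tau : forall n, I n -> R, forall n f (t : I n -> R),
    (forall a, S a -> `|J a f - t (c n a)| <= 1) ->
    `|T f - \sum_i tau n i * t i| <= C.
  by exists (fun n => sval (cid (quadrature (c n)))) => n; case: cid.
pose y n := \sum_i tau n i *: v i.
(* Uniformity over the polar of [W] is what makes the sums [y n] a Cauchy sequence in [F]. *)
have yP W e : nbhs 0 W -> 0 < e -> \forall n \near \oo,
    forall (lam : {linear F -> R^o}) f, polar W lam ->
    (forall a, S a -> J a f = lam (Gam a)) -> `|T f - lam (y n)| <= C * e.
  move=> W0 e0; have := Gam_step (nbhs0_scale e^-1 W0).
  apply: filterS => n nW lam f plam Jf.
  pose t (i : I n) := e^-1 * lam (v i).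
  have /tauP : forall a, S a -> `|J a (e^-1 *: f) - t (c n a)| <= 1.
    move=> a Sa; have [j jE] := linear_bundle (J_linear Sa).
    rewrite -jE linearZ/= jE Jf// -[_ *: _]/(e^-1 * lam (Gam a)) -mulrBr normrM.
    rewrite gtr0_norm ?invr_gt0// ler_pdivrMl// mulr1 -linearB.
    by apply: polar_scale plam _ => //; exact: nW.
  have -> : T (e^-1 *: f) - \sum_i tau n i * t i =
      e^-1 * (T f - lam (y n)).
    rewrite linearZ/= mulrBr -[_ *: _]/(e^-1 * T f); congr (_ - _).
    rewrite /y linear_sum mulr_sumr; apply: eq_bigr => i _.
    rewrite linearZ/= -[tau n i *: _]/(tau n i * (lam (v i) : R)).
    exact: mulrCA.
  by rewrite normrM gtr0_norm ?invr_gt0// ler_pdivrMl// mulrC.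
have [l yl] : exists l : F, y @ \oo --> l.
  apply: F_complete => U /nbhs0_disked[W [W0 dW WU]].
  (* With this [e], both [lam (y m)] and [lam (y n)] are within 1/4 of [T f], hence within 1/2 < 1
     of each other. *)
  have e0 : 0 < (4 * C)^-1 by rewrite invr_gt0 mulr_gt0.
  have [N _ NP] := yP _ _ W0 e0.
  exists N => m n Nm Nn; apply: WU; apply: in_nbhs_polar => // lam clam plam.
  have [f Jf] := dual_comp clam.
  have := NP m Nm lam f plam Jf; have := NP n Nn lam f plam Jf.
  have -> : C / (4 * C) = 4^-1.
    by rewrite invfM mulrCA divff ?mulr1// gt_eqF.
  rewrite linearB/= => h1 h2.
  have -> : lam (y m) - lam (y n) = (T f - lam (y n)) - (T f - lam (y m)) by ring.
  by apply: le_lt_trans (ler_normB _ _) _; apply: le_lt_trans (lerD h1 h2) _; lra.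
exists l => lam f clam Jf; have [W [W0 dW plam]] := continuous_polar clam.
have lyl : (lam \o y) n @[n --> \oo] --> lam l
  by apply: continuous_cvg => //; exact: clam.
apply: (@cvg_unique R^o (@Rhausdorff R) ((lam \o y) n @[n --> \oo]) _ _ _ _ lyl).
apply/cvgrPdist_le => /= e e0; have := yP W (e / C) W0 (divr_gt0 e0 C_gt0).
by apply: filterS => n /(_ lam f plam Jf); rewrite mulrC divfK ?gt_eqF.
Qed.

End WeakIntegral.

(** * The topology of the spaces of differentiable functions *)

Section CompactOpen.
Context {R : realType} {X : topologicalType} {F : tvsType R}.

(** Uniform closeness is expressed by differences and neighbourhoods of 0, because the uniform
    structure carried by [F] need not be translation invariant. *)
Lemma cvg_compact_openP (G : set_system {compact-open, X -> F}) (f : X -> F) :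
  Filter G -> continuous f ->
  {compact-open, G --> f} <->
  forall K W, compact K -> nbhs 0 W ->
    G [set g | forall z, K z -> W (g z - f z)].
Proof.
move=> FG cf; split=> [/compact_open_cvgP Gf K U cK /nbhs0_disked[W [W0 dW WU]]|GW].
  have /compact_near_coveringP/near_covering_withinP := cK.
  move=> /(_ _ G (fun g z => U (g z - f z)) FG); apply=> x Kx.
  pose W2 := [set y | W (2 *: (y - f x))].
  have W2x : nbhs (f x) W2 by exact: nbhs0_shift (nbhs0_scale _ W0).
  (* Regularity provides a closed neighbourhood of [f x]; its preimage meets [K] in a compact set,
     to which a subbasic set of the compact-open topology belongs. *)
  have [B Bx BW] := @uniform_regular F (f x) _ (nbhs_interior W2x).
  have cV : closed (f @^-1` closure B).
    by apply: preimage_closed => //; exact: closed_closure.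
  have GO : G [set g | g @` (K `&` f @^-1` closure B) `<=` W2°].
    apply: Gf; [exact: compact_closedI|exact: open_interior|].
    by move=> _ [z [_ Vz] <-]; exact: BW.
  have Vx : nbhs x (f @^-1` closure B).
    by apply: cf; apply: filterS Bx; exact: subset_closure.
  exists (f @^-1` closure B, [set g | g @` (K `&` f @^-1` closure B) `<=` W2°]) => //.
  move=> [z g] [/= Vz gO] Kz.
  have /interior_subset/= gz : W2° (g z) by apply: gO; exists z.
  have /interior_subset/= fz : W2° (f z) by exact: BW.
  apply: WU; have -> : g z - f z =
      2^-1 *: (2 *: (g z - f x)) + (- 2^-1) *: (2 *: (f z - f x)).
    by rewrite !scalerA mulNr mulVf// scale1r scaleN1r opprB addrA subrK.
  by apply: dW => //; rewrite normrN gtr0_norm; lra.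
apply/compact_open_cvgP => K O cK oO fKO.
(* By compactness, one neighbourhood of 0 consists of vectors [v] that keep [f z + v] in [O] for all
   [z] in [K]. *)
have KO : \forall v \near (0 : F), K `<=` (fun z => O (f z + v)).
  have /compact_near_coveringP := cK; apply=> x Kx.
  have := @add_continuous F (f x, 0) O.
  rewrite /= addr0 => /(_ (open_nbhs_nbhs (conj oO (fKO _ (imageP f Kx))))).
  move=> [B/= [B1 B2] BO].
  exists (f @^-1` B.1, B.2); first by split=> //; exact: cf.
  by move=> [z v] [/= Bz Bv]; exact: (BO (f z, v)).
have := GW _ _ cK KO; apply: filterS => g gW _ [z Kz <-].
by rewrite -[g z](subrK (f z)) addrC; apply: (gW z Kz z Kz).
Qed.

End CompactOpen.

Lemma cvg_initialP (S : choiceType) (T : topologicalType) (f : S -> T)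
    (G : set_system S) (s : S) : Filter G ->
  G --> (s : initial_topology f) <-> f @ G --> f s.
Proof.
move=> FG; split=> [Gs A fA|Gfs A].
  exact: Gs (@initial_continuous S T f s _ fA).
rewrite nbhsE => -[_ [[B oB <-] Bfs] BA]; apply: filterS BA _.
by apply: Gfs; exact: open_nbhs_nbhs.
Qed.

Section ClTheory.
Context {R : realType} {d : nat} {l : option nat} {D : set 'rV[R]_d}
  {F : lcsType R}.
Hypothesis D_dense : D `<=` closure D°.
Implicit Types (a : {ffun 'I_d -> nat}) (g h : Cl l D F).

Lemma mpderiv_ext_unique a (g u v : D -> F) :
  is_mpderiv_ext a g u -> is_mpderiv_ext a g v -> u = v.
Proof.
move=> [cu uE] [cv vE]; apply/funext => x; apply: lcs_hausdorff => A B nA nB.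
have : nbhs x (u @^-1` A `&` v @^-1` B).
  by apply: filterI; [exact: cu nA|exact: cv nB].
rewrite nbhsE => -[_ [[Q oQ <-] Qx] QAB].
have [z [Dz Qz]] : (D° `&` Q) !=set0.
  apply: D_dense; first exact: set_valP.
  exact: open_nbhs_nbhs.
have zD := mem_set (interior_subset Dz).
pose z' : D := SigSub zD.
have [uz vz] := QAB z' Qz.
by exists (u z'); split=> //; rewrite uE// -vE.
Qed.

Lemma is_Cl_Cl g : is_Cl l g.
Proof. exact/asboolP/(valP g). Qed.

Lemma Cl_mpderivP a g : ord_le (mindex_size a) l ->
  is_mpderiv_ext a g (Cl_mpderiv a g).
Proof. by move=> al; have [_ _ /(_ a al) eg] := is_Cl_Cl g; exact: xgetPex. Qed.

Lemma Cl_mpderivE a g (u : D -> F) : is_mpderiv_ext a g u -> Cl_mpderiv a g = u.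
Proof.
move=> gu; apply: xget_unique => // v gv; exact: mpderiv_ext_unique gv gu.
Qed.

Lemma Cl_mpderiv_lin a (c : R) g h : ord_le (mindex_size a) l ->
  Cl_mpderiv a (c *: g + h) = c *: Cl_mpderiv a g + Cl_mpderiv a h.
Proof.
move=> al; apply: Cl_mpderivE.
have [[cu uE] [cv vE]] := (Cl_mpderivP g al, Cl_mpderivP h al).
have [[_ Cg _] [_ Ch _]] := (is_Cl_Cl g, is_Cl_Cl h).
split=> [x|x Dx]; first by apply: (cvg_lin (nbhs_filter x)); [exact: cu|exact: cv].
rewrite -(eq_on_mpderiv a (open_interior D) (@valL_lin _ _ _ _ c g h)) ?inE//.
by rewrite (mpderiv_lin c (open_interior D) Cg Ch) ?inE// !fctE uE ?vE.
Qed.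

Lemma Cl_cvgP (G : set_system (Cl l D F)) g : Filter G ->
  G --> g <-> forall a, ord_le (mindex_size a) l -> forall K W,
    compact K -> nbhs 0 W ->
    G [set h | forall z, K z -> W (Cl_mpderiv a h z - Cl_mpderiv a g z)].
Proof.
move=> FG; split=> [/cvg_sup Gg a al K W cK W0|Gg].
  have /cvg_initialP Ga := Gg (exist _ a al).
  have ca := (Cl_mpderivP g al).1.
  exact: ((cvg_compact_openP _ ca).1 Ga K W cK W0).
apply/cvg_sup => -[a al]; apply/cvg_initialP/cvg_compact_openP.
  exact: (Cl_mpderivP g al).1.
exact: Gg.
Qed.

(** The sets described by finitely many indices, a compact set and a neighbourhood of 0 generate a
    filter. It converges to [g] by [Cl_cvgP], hence contains every neighbourhood of [g]. *)
Lemma Cl_nbhs_basis g (N : set (Cl l D F)) : nbhs g N ->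
  exists (s : seq {ffun 'I_d -> nat}) K (W : set F),
  [/\ forall a, a \in s -> ord_le (mindex_size a) l,
    compact K, nbhs 0 W &
    forall h, (forall a z, a \in s -> K z ->
      W (Cl_mpderiv a h z - Cl_mpderiv a g z)) -> N h].
Proof.
pose I := (seq {ffun 'I_d -> nat} * set D * set F)%type.
pose dom : set I := [set t : I | [/\ forall a, a \in t.1.1 -> ord_le (mindex_size a) l,
  compact t.1.2 & nbhs 0 t.2]].
pose B (t : I) : set (Cl l D F) := [set h | forall a z, a \in t.1.1 -> t.1.2 z ->
      t.2 (Cl_mpderiv a h z - Cl_mpderiv a g z)].
have FB : Filter (filter_from dom B).
  apply: filter_from_filter.
    by exists ([::], set0, setT); split=> //=; [exact: compact0|exact: filterT].
  move=> [[s1 K1] W1] [[s2 K2] W2] [/= l1 c1 n1] [/= l2 c2 n2].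
  exists (s1 ++ s2, K1 `|` K2, W1 `&` W2); first split=> /=.
  - by move=> a; rewrite mem_cat => /orP[/l1|/l2].
  - exact: compactU.
  - exact: filterI.
  move=> h Bh; split=> a z /= as_ Kz.
    by have [] := Bh a z; rewrite /= ?mem_cat ?as_//; left.
  by have [] := Bh a z; rewrite /= ?mem_cat ?as_ ?orbT//; right.
have /[apply] : filter_from dom B --> g.
  apply/Cl_cvgP => a al K W cK W0; exists ([:: a], K, W).
    by split=> //= b; rewrite inE => /eqP ->.
  by move=> h Bh z Kz; apply: Bh => //=; rewrite inE.
by move=> [[[s K] W] [/= ls cK W0] BN]; exists s, K, W.
Qed.

Lemma Cl_mpderiv_linear a z : ord_le (mindex_size a) l ->
  linear (fun g => Cl_mpderiv a g z).
Proof. by move=> al c g h; rewrite Cl_mpderiv_lin. Qed.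

End ClTheory.

(** * Multi-indices and the outermost derivative *)

Section MultiIndices.
Context {d : nat}.
Implicit Types (a b : {ffun 'I_d -> nat}).

Definition mindex_incr a k : {ffun 'I_d -> nat} := [ffun j => (a j + (j == k))%N].
Definition mindex_decr a k : {ffun 'I_d -> nat} := [ffun j => (a j - (j == k))%N].

Lemma mindex_decrK a k : (0 < a k)%N -> mindex_incr (mindex_decr a k) k = a.
Proof.
move=> ak; apply/ffunP => j; rewrite !ffunE.
by have [->|jk] := eqVneq j k; rewrite ?addn0 ?subn0// subnK.
Qed.

Lemma mindex_incrK a k : mindex_decr (mindex_incr a k) k = a.
Proof. by apply/ffunP => j; rewrite !ffunE addnK. Qed.

Lemma mindex_size_incr a k : mindex_size (mindex_incr a k) = (mindex_size a).+1.
Proof.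
rewrite /mindex_size (bigD1 k)//= [in RHS](bigD1 k)//= ffunE eqxx addn1 addSn.
by congr (_ + _).+1; apply: eq_bigr => j /negbTE jk; rewrite ffunE jk addn0.
Qed.

Lemma mindex_size_decr a k : (0 < a k)%N ->
  mindex_size a = (mindex_size (mindex_decr a k)).+1.
Proof. by move=> /mindex_decrK {1}<-; rewrite mindex_size_incr. Qed.

(* Unlike mindex_size_succ, the index k does not depend on the codomain. *)
Lemma mpderiv_split (R : realType) a : (0 < mindex_size a)%N ->
  exists k, (0 < a k)%N /\
    forall (F : lcsType R) (f : 'rV[R]_d -> F),
      mpderiv a f = pderiv k (mpderiv (mindex_decr a k) f).
Proof.
rewrite /mindex_size -big_enum /mpderiv.
elim: (enum 'I_d) (enum_uniq 'I_d) => [|i s IH] /=; first by rewrite big_nil.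
move=> /andP[i_s us]; rewrite big_cons.
have [ai0|ai0 _] := posnP (a i).
  rewrite ai0 add0n => /(IH us)[j [aj fE]]; exists j; split=> // F f.
  by rewrite ffunE ai0 sub0n /= fE.
exists i; split=> // F f; rewrite ffunE eqxx subn1 -[in LHS](prednK ai0) iterS.
congr (pderiv i (iter _ _ _)).
elim: s i_s {IH us} => //= j s IH; rewrite in_cons negb_or => /andP[ij /IH ->].
by rewrite ffunE eq_sym (negbTE ij) subn0.
Qed.

End MultiIndices.

(** * Composition with continuous linear maps *)

Section Postcomposition.
Context {R : realType} {d : nat} {F F' : lcsType R} (lam : {linear F -> F'}).
Hypothesis lam_continuous : continuous lam.
Implicit Types (a : {ffun 'I_d -> nat}) (l : option nat).

Lemma is_pderiv_comp i (f : 'rV[R]_d -> F) x y :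
  is_pderiv i f x y -> is_pderiv i (lam \o f) x (lam y).
Proof.
move=> fy; rewrite /is_pderiv.
under eq_fun do rewrite /= -linearB -linearZ.
by apply: continuous_cvg => //; exact: lam_continuous.
Qed.

Section on_open.
Variables (l : option nat) (U : set 'rV[R]_d) (f : 'rV[R]_d -> F).
Hypotheses (oU : open U) (Cf : Cl_on l U f).

Lemma mpderiv_comp a : ord_le (mindex_size a) l ->
  {in U, mpderiv a (lam \o f) =1 lam \o mpderiv a f}.
Proof.
move en : (mindex_size a) => n; elim: n a en => [|n IH] a an al.
  by rewrite !mindex_size_eq0.
have [i [ai aE]] := mpderiv_split R (a := a) ltac:(by rewrite an).
have bn : mindex_size (mindex_decr a i) = n.
  by apply: succn_inj; rewrite -mindex_size_decr.
rewrite !aE => x xU; rewrite (eq_on_pderiv i oU (IH _ bn (ord_leS al)) xU).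
move: xU => /set_mem xU; apply: is_pderivE; apply: is_pderiv_comp.
by apply: pderivP; apply: Cf.1; rewrite ?bn.
Qed.

Lemma Cl_on_comp : Cl_on l U (lam \o f).
Proof.
have eqc a (al : ord_le (mindex_size a) l) :
    {in U, lam \o mpderiv a f =1 mpderiv a (lam \o f)}.
  by move=> x xU; rewrite mpderiv_comp.
split=> [a i|a] x al Ux.
  apply: (eq_on_pderivable oU Ux (eqc a (ord_leS al))).
  have [y fy] := Cf.1 a i x al Ux; exists (lam y); exact: is_pderiv_comp.
apply: (eq_on_continuous oU Ux (eqc a al)).
by apply: continuous_comp; [exact: Cf.2|exact: lam_continuous].
Qed.

End on_open.

Context {l : option nat} {D : set 'rV[R]_d}.

Lemma valL_comp (g : D -> F) : 'valL_0 (lam \o g) = lam \o 'valL_0 g.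
Proof.
apply/funext => x; rewrite /valL_ /=.
by case: ('oinv_set_val x) => //=; rewrite linear0.
Qed.

Lemma mpderiv_ext_comp a (g u : D -> F) : ord_le (mindex_size a) l ->
  is_Cl l g -> is_mpderiv_ext a g u -> is_mpderiv_ext a (lam \o g) (lam \o u).
Proof.
move=> al [_ Cg _] [cu uE]; split=> [x|x Dx].
  by apply: continuous_comp; [exact: cu|exact: lam_continuous].
by rewrite valL_comp (mpderiv_comp (open_interior D) Cg) ?inE//= uE.
Qed.

Lemma is_Cl_comp (g : D -> F) : is_Cl l g -> is_Cl l (lam \o g).
Proof.
move=> Clg; have [cg Cg eg] := Clg; split.
- by move=> x; apply: continuous_comp; [exact: cg|exact: lam_continuous].
- by rewrite valL_comp; exact: Cl_on_comp (open_interior D) Cg.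
- move=> a al; have [u gu] := eg a al.
  by exists (lam \o u); exact: mpderiv_ext_comp.
Qed.

Lemma Cl_comp_subproof (g : Cl l D F) : lam \o g \in @Cl_pred R d l D F'.
Proof. by apply/asboolP/is_Cl_comp/is_Cl_Cl. Qed.

Definition Cl_comp (g : Cl l D F) : Cl l D F' := MkCl (Cl_comp_subproof g).

Lemma Cl_comp_mpderiv a (g : Cl l D F) : D `<=` closure D° ->
  ord_le (mindex_size a) l ->
  Cl_mpderiv a (Cl_comp g) = lam \o Cl_mpderiv a g.
Proof.
move=> Dd al; apply: Cl_mpderivE => //.
by apply: mpderiv_ext_comp => //; [exact: is_Cl_Cl|exact: Cl_mpderivP].
Qed.

End Postcomposition.

Section LinearBound.
Context {R : realType} {d : nat} {l : option nat} {D D' : set 'rV[R]_d}.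
Hypotheses (D_dense : D `<=` closure D°) (D'_dense : D' `<=` closure D'°).

(** Continuity at 0 gives a basic neighbourhood on which the target seminorm is at most 1;
    homogeneity turns this into a bound. *)
Lemma Cl_linear_bound (E : {linear Cl l D R^o -> Cl l D' R^o})
    (a : {ffun 'I_d -> nat}) (L : set D') :
  continuous E -> ord_le (mindex_size a) l -> compact L ->
  exists (s : seq {ffun 'I_d -> nat}) (K : set D) (C : R),
    [/\ forall b, b \in s -> ord_le (mindex_size b) l, compact K, 0 < C &
      forall f : Cl l D R^o,
        (forall b z, b \in s -> K z -> `|Cl_mpderiv b f z : R| <= 1) ->
        forall x, L x -> `|Cl_mpderiv a (E f) x : R| <= C].
Proof.
move=> cE al cL.
have dn1 : nbhs (0 : R^o) [set y : R^o | `|y| <= 1].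
  by apply/nbhs_ballP; exists 1 => //= y; rewrite /ball/= sub0r normrN => /ltW.
have jB (S : set 'rV[R]_d) (Sd : S `<=` closure S°) b (bl : ord_le (mindex_size b) l) z :
    exists j : {linear Cl l S R^o -> R^o}, forall f, Cl_mpderiv b f z = j f.
  by have [j jE] := linear_bundle (Cl_mpderiv_linear (F := R^o) Sd z bl); exists j.
have : nbhs (E 0) [set h | forall x, L x ->
    `|Cl_mpderiv a h x - Cl_mpderiv a (E 0) x : R| <= 1].
  have /Cl_cvgP EE : nbhs (E 0) --> E 0 by exact: cvg_id.
  exact: (EE a al L _ cL dn1).
move=> /cE/Cl_nbhs_basis[s [K [W [ls cK /nbhs_ballP[e /= e0 eW] KW]]]].
(* Scaling by [e / 2] turns the weak bound 1 into a strict bound by the radius [e] of the open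
   ball. *)
have e20 : 0 < e / 2 by rewrite divr_gt0.
exists s, K, (e / 2)^-1; split=> //; first by rewrite invr_gt0.
move=> f f1 x Lx; have := KW ((e / 2) *: f) _ x Lx.
have [j jE] := jB _ D'_dense _ al x.
rewrite /= !jE !linear0 addr0.
have -> : j (E ((e / 2) *: f)) = e / 2 * j (E f) by rewrite !linearZ.
rewrite normrM.
rewrite gtr0_norm// -ler_pdivlMl// mulr1; apply=> b z bs Kz; apply: eW.
have [k kE] := jB _ D_dense _ (ls _ bs) z.
rewrite !kE !linear0 addr0 /ball/= sub0r normrN.
have -> : k ((e / 2) *: f) = e / 2 * k f by rewrite linearZ.
rewrite normrM gtr0_norm//.
apply: le_lt_trans (_ : e / 2 < e); last by lra.
by rewrite ler_piMr ?(ltW e20)//; have := f1 b z bs Kz; rewrite kE.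
Qed.

End LinearBound.

(** * Mixed partial derivatives and weak derivatives *)

Lemma near_dnbhs0 (R : realType) (P : set R) (e : R) : 0 < e ->
  (forall h, h != 0 -> `|h| < e -> P h) -> \forall h \near 0^', P h.
Proof.
move=> e0 eP; suff : nbhs (0 : R) (fun h => h != 0 -> P h) by [].
apply/nbhs_ballP; exists e => //= h; rewrite /ball/= sub0r normrN => he h0.
exact: eP.
Qed.

Section ScalarCalculus.
Context {R : realType} {d : nat}.
Local Notation E := 'rV[R]_d.
Implicit Types (f g : E -> R^o) (x : E) (i j : 'I_d).

Lemma line_cvg i x : (fun h : R => x + h *: delta_mx 0 i : E) @ 0 --> x.
Proof.
have : {for 0, continuous (fun h : R => x + h *: (delta_mx 0 i : E))}.
  apply: (@continuousD _ _ _ (cst x)); first exact: cst_continuous.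
  exact: scalel_continuous.
by rewrite /prop_for /continuous_at /= scale0r addr0.
Qed.

Lemma line_near i x (P : set E) : nbhs x P ->
  exists2 e : R, 0 < e & forall h, `|h| < e -> P (x + h *: delta_mx 0 i).
Proof.
move=> /(line_cvg i)/nbhs_ballP[e /= e0 eP]; exists e => // h he.
by apply: eP; rewrite /ball/= sub0r normrN.
Qed.

(** The one-variable theorem for [s |-> g (x + s e_i)]; the intermediate point is written as a
    multiple of [h] to cover both signs of [h]. *)
Lemma pderiv_mvt i g (g' : E -> R) : (forall x, is_pderiv i g x (g' x)) ->
  forall x h, exists t, `|t| <= 1 /\
    g (x + h *: delta_mx 0 i) - g x = h * g' (x + (t * h) *: delta_mx 0 i).
Proof.
move=> gg' x h; pose phi (s : R) : R^o := g (x + s *: delta_mx 0 i).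
have dphi (s : R) : is_derive s 1 phi (g' (x + s *: delta_mx 0 i)).
  have : (fun k : R => k^-1 *: ((phi \o shift s) (k *: 1) - phi s)) @ 0^' -->
      (g' (x + s *: delta_mx 0 i) : R^o).
    under eq_fun => k.
      rewrite /phi /= -[k *: 1]/(k * 1) mulr1 [k + s]addrC scalerDl addrA.
      over.
    exact: gg'.
  move=> L; apply: DeriveDef; first exact: cvgP L.
  exact: cvg_lim L.
have mvt a b : a <= b -> exists2 c, a <= c <= b &
    phi b - phi a = g' (x + c *: delta_mx 0 i) * (b - a).
  move=> ab; have [|c cab Ec] := @MVT_segment R phi _ a b ab (fun s _ => dphi s).
    by apply: derivable_within_continuous => s _; case: (dphi s).
  by exists c => //; rewrite in_itv in cab.
have phi0 : phi 0 = g x by rewrite /phi scale0r addr0.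
have phih : phi h = g (x + h *: delta_mx 0 i) by [].
rewrite -phih -phi0; have [h0|h0|->] := ltgtP h 0; last first.
- by exists 0; rewrite normr0 subrr mul0r.
- have [c /andP[c0 ch] ->] := mvt 0 h (ltW h0); exists (c / h).
  rewrite divfK ?gt_eqF// subr0; split; last by rewrite mulrC.
  by rewrite ger0_norm ?divr_ge0 ?(ltW h0)// ler_pdivrMr// mul1r.
- have [c /andP[ch c0] Ec] := mvt h 0 (ltW h0); exists (c / h).
  rewrite divfK ?lt_eqF//; split; last first.
    by rewrite -opprB Ec sub0r mulrN opprK mulrC.
  rewrite ger0_norm ?ler_ndivrMr// ?mul1r//.
  by rewrite -mulrNN -invrN divr_ge0 ?oppr_ge0 ?(ltW h0).
Qed.

(** Two applications of the mean value theorem show that the second difference quotient [q h k] is a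
    value of [pderiv j (pderiv i f)] near [x]. Letting [k] tend to 0 gives the difference quotient
    of [pderiv j f]. *)
Lemma schwarz i j f x :
  (forall z, pderivable i f z) -> (forall z, pderivable j f z) ->
  (forall z, pderivable j (pderiv i f) z) ->
  {for x, continuous (pderiv j (pderiv i f))} ->
  is_pderiv i (pderiv j f) x (pderiv j (pderiv i f) x).
Proof.
move=> fi fj fij cf; set c := pderiv j (pderiv i f) x.
pose q (h k : R) : R^o := k^-1 * (h^-1 * (f (x + h *: delta_mx 0 i + k *: delta_mx 0 j)
  - f (x + k *: delta_mx 0 j) - (f (x + h *: delta_mx 0 i) - f x))).
apply/cvgrPdist_le => /= e e0.
have [rho rho0 near_c] : exists2 r : R, 0 < r & forall h k, `|h| < r -> `|k| < r ->
    `|c - pderiv j (pderiv i f) (x + h *: delta_mx 0 i + k *: delta_mx 0 j)| <= e.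
  have /cvgrPdist_le/(_ e e0)/nbhs_ballP[r /= r0 rP] := cf.
  have mx1 k (h : R) : `|h *: (delta_mx 0 k : E)| <= `|h|.
    rewrite normrZ ler_piMr//.
    have [D0|/mx_norm_neq0[u uE]] := eqVneq (mx_norm (delta_mx 0 k : E)) 0.
      by rewrite [leLHS]D0.
    by rewrite [leLHS]uE mxE; case: (_ && _); rewrite ?normr1 ?normr0.
  (* Each of the two displacements has norm below [r / 2], as unit vectors have sup norm at most
     1. *)
  exists (r / 2) => [|h k hr kr]; first by rewrite divr_gt0.
  apply: rP; rewrite -ball_normE /= -addrA opprD addrA subrr sub0r normrN.
  apply: le_lt_trans (ler_normD _ _) _.
  by have := mx1 i h; have := mx1 j k; lra.
have q_near h k : h != 0 -> k != 0 -> `|h| < rho -> `|k| < rho -> `|c - q h k| <= e.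
  move=> h0 k0 hr kr.
  have scale_lt t s : `|t| <= 1 -> `|s| < rho -> `|t * s| < rho.
    by move=> t1 sr; apply: le_lt_trans sr; rewrite normrM ler_piMl.
  pose g z : R^o := f (z + k *: delta_mx 0 j) - f z.
  have gP z : is_pderiv i g z (pderiv i f (z + k *: delta_mx 0 j) - pderiv i f z).
    rewrite addrC -scaleN1r -[g](_ : -1 *: f + (fun z => f (z + k *: delta_mx 0 j)) = _).
      apply: is_pderiv_lin; first exact: pderivP.
      have := pderivP (fi (z + k *: delta_mx 0 j)); rewrite /is_pderiv.
      by under eq_fun do rewrite addrAC.
    by apply/funext => y; rewrite !fctE scaleN1r addrC.
  have [t [t1 tE]] := pderiv_mvt gP x h.
  have [s [s1 sE]] :=
    pderiv_mvt (fun z => pderivP (fij z)) (x + (t * h) *: delta_mx 0 i) k.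
  have -> : q h k = pderiv j (pderiv i f)
      (x + (t * h) *: delta_mx 0 i + (s * k) *: delta_mx 0 j).
    rewrite /q.
    rewrite [X in h^-1 * X](_ : _ = g (x + h *: delta_mx 0 i) - g x); last first.
      by rewrite /g; ring.
    by rewrite tE mulKf// sE mulKf.
  by apply: near_c; exact: scale_lt.
suff near_h h : h != 0 -> `|h| < rho ->
    `|c - h^-1 *: (pderiv j f (x + h *: delta_mx 0 i) - pderiv j f x)| <= e.
  exact: near_dnbhs0 near_h.
move=> h0 hr.
have qcvg : q h @ 0^' --> h^-1 *: (pderiv j f (x + h *: delta_mx 0 i) - pderiv j f x).
  have L1 := pderivP (fj (x + h *: delta_mx 0 i)); have L2 := pderivP (fj x).
  have L := cvg_lin (c := -1) (dnbhs_filter _) L2 L1.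
  have Z : (fun=> 0 : R^o) @ (0 : R)^' --> (0 : R^o) by exact: cvg_cst.
  have := cvg_lin (c := h^-1) (dnbhs_filter _) L Z.
  rewrite addr0 scaleN1r [- _ + _]addrC.
  under eq_fun => k.
    have -> : h^-1 *: (-1 *: (k^-1 *: (f (x + k *: delta_mx 0 j) - f x)) +
        k^-1 *: (f (x + h *: delta_mx 0 i + k *: delta_mx 0 j) -
          f (x + h *: delta_mx 0 i))) + 0 = q h k.
      by rewrite /q /GRing.scale/=; ring.
    over.
  by [].
apply: (closed_cvg (fun y : R^o => `|c - y| <= e) _ _ _ qcvg).
  apply: (@closed_comp R^o R^o (fun y : R^o => `|c - y|) [set y | y <= e]) => [y _|].
    by apply: cvg_norm; apply: cvgB; [exact: cvg_cst|exact: cvg_id].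
  exact: closed_le.
by apply: near_dnbhs0 rho0 _ => k k0 kr; exact: q_near.
Qed.

(** [mpderiv] differentiates in a fixed order. If the outermost direction [k] of the increased index
    is not [i], then [a] is [c] increased at [k], and [schwarz] exchanges the two derivatives of
    [mpderiv c f]. *)
Lemma pderiv_mpderiv l f (a : {ffun 'I_d -> nat}) i :
  Cl_on l setT f -> ord_le (mindex_size a).+1 l ->
  pderiv i (mpderiv a f) = mpderiv (mindex_incr a i) f.
Proof.
move=> [df cf]; move en : (mindex_size a) => n.
elim: n a i en => [|n IH] a i an al.
all: have sl : ord_le (mindex_size (mindex_incr a i)) l by rewrite mindex_size_incr an.
all: have [k [ak kE]] := mpderiv_split R (a := mindex_incr a i)
  ltac:(by rewrite mindex_size_incr).
all: have [ik|ki] := eqVneq i k; first by rewrite kE -ik mindex_incrK.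
all: have {}ak : (0 < a k)%N by move: ak; rewrite ffunE eq_sym (negbTE ki) addn0.
  move: an; rewrite /mindex_size (bigD1 k)//= => /eqP.
  by rewrite addn_eq0 => /andP[/eqP]; lia.
pose c := mindex_decr a k.
have cn : mindex_size c = n.
  by apply: succn_inj; rewrite -an [RHS](mindex_size_decr ak).
have aE : mindex_incr c k = a by exact: mindex_decrK.
have ciE : mindex_decr (mindex_incr a i) k = mindex_incr c i.
  apply/ffunP => j; rewrite !ffunE; have [->|_] := eqVneq j k; last by rewrite !subn0.
  by rewrite eq_sym (negbTE ki) !addn0.
have al' := ord_leS al.
rewrite kE ciE -(IH c i cn al') -aE -(IH c k cn al').
apply/funext => x; apply: is_pderivE; apply: schwarz => [z|z|z|].
- by apply: df => //; rewrite cn.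
- by apply: df => //; rewrite cn.
- by rewrite (IH c i cn al'); apply: df; rewrite // mindex_size_incr cn.
- by rewrite (IH c i cn al') -ciE -kE; apply: cf.
Qed.

End ScalarCalculus.

Section WeakDerivative.
Context {R : realType} {d : nat} {F : lcsType R}.

(** The intermediate point of the mean value theorem depends on the form, but always lies on a short
    segment where [H] is uniformly close to [H x]. *)
Lemma weak_pderiv (i : 'I_d) (G H : 'rV[R]_d -> F) x :
  {for x, continuous H} ->
  (forall lam : {linear F -> R^o}, continuous lam ->
    forall z, is_pderiv i (lam \o G) z (lam (H z))) ->
  is_pderiv i G x (H x).
Proof.
move=> cH GH U /nbhs_shift0/nbhs0_disked[W [W0 dW WU]].
(* The factor 2 yields the bound 1/2, hence the strict inequality wanted by [in_nbhs_polar]. *)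
have [e e0 eW] := line_near i (cH _ (nbhs0_shift (H x) (nbhs0_scale 2 W0))).
apply: (near_dnbhs0 e0) => h h0 he /=.
rewrite -[h^-1 *: _](subrKC (H x)); apply: WU.
apply: in_nbhs_polar => // lam clam plam.
have [t [t1 tE]] := pderiv_mvt (GH lam clam) x h.
rewrite linearB linearZ linearB/= in tE *.
rewrite tE -[h^-1 *: _]/(h^-1 * (h * _)) mulKf// -linearB.
have the : `|t * h| < e by apply: le_lt_trans he; rewrite normrM ler_piMl.
have := plam _ (eW _ the); rewrite /= linearZ/= normrM.
have -> : `|2 : R| = 2 by rewrite normr_nat.
by move=> le1; lra.
Qed.

End WeakDerivative.

(** * Compactness and total boundedness *)

Lemma near_all_seq (T : eqType) (I : Type) (G : set_system I) (s : seq T)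
    (P : T -> I -> Prop) : Filter G ->
  (forall b, b \in s -> \forall x \near G, P b x) ->
  \forall x \near G, forall b, b \in s -> P b x.
Proof.
move=> FG; elim: s => [|b s IH] sP; first by apply: filterE.
have sP' : \forall x \near G, forall b, b \in s -> P b x.
  by apply: IH => b' b's; apply: sP; rewrite inE b's orbT.
apply: filterS2 (sP b (mem_head _ _)) sP' => x Pb Ps b'.
by rewrite inE => /predU1P[->|/Ps].
Qed.

Section Compactness.
Context {R : realType} {X : pseudoMetricType R} (K : set X).
Hypothesis K_compact : compact K.

Lemma compact_bounded_fun (f : X -> R^o) : continuous f ->
  exists M : R, forall z, K z -> `|f z| <= M.
Proof.
move=> cf.
have /compact_bounded[M [_ MP]] : compact (f @` K).
  by apply: continuous_compact => //; exact: continuous_subspaceT.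
exists (M + 1) => z Kz; apply: (MP (M + 1)); first by rewrite ltrDl.
by exists z.
Qed.

(* compact_cover would require a pointed type; near coverings are used instead,
   with the filter of the large finite sequences. *)
Lemma compact_net (e : R) : 0 < e ->
  exists cs : seq X, forall z, K z -> exists2 z', z' \in cs & ball z' e z.
Proof.
move=> e0; pose B (t : seq X) := [set cs : seq X | {subset t <= cs}].
have FB : Filter (filter_from setT B).
  apply: filter_from_filter; first by exists [::].
  move=> s t _ _; exists (s ++ t) => // u stu.
  by split=> x xs; apply: stu; rewrite mem_cat xs ?orbT.
have [x Kx|t _ tP] := (compact_near_coveringP K).1 K_compact _ _
  (fun (cs : seq X) z => exists2 z', z' \in cs & ball z' e z) FB.
  exists (ball x e, B [:: x]).
    by split; [exact: nbhsx_ballx|exists [:: x]].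
  by move=> [z cs] [/= xz xcs]; exists x => //; apply: xcs; rewrite inE.
by exists t => z Kz; apply: (tP t).
Qed.

Context {F : tvsType R} {B : eqType} (b0 : B) (s : seq B) (u : B -> X -> F).
Hypothesis u_continuous : forall b, b \in s -> continuous (u b).

(** At stage [n], each [z] in [K] is replaced by the first point of a finite net at distance below
    [1 / (n + 1)]. Uniform continuity on [K] controls the error. *)
Lemma compact_step_approximation :
  exists (I : nat -> finType) (c : forall n, B * X -> I n) (v : forall n, I n -> F),
    forall W, nbhs 0 W -> \forall n \near \oo,
      forall b z, b \in s -> K z -> W (u b z - v n (c n (b, z))).
Proof.
have e0 n : 0 < n.+1%:R^-1 :> R by rewrite invr_gt0.
pose cs n := sval (cid (compact_net (e0 n))).
have csP n z : K z -> exists2 z', z' \in cs n & ball z' n.+1%:R^-1 z.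
  by rewrite /cs; case: cid => /= t; apply.
(* The additional element leaves room for the values of [index] and [find] on failure. *)
exists (fun n => ('I_(size s).+1 * 'I_(size (cs n)).+1)%type : finType).
exists (fun n a => (inord (index a.1 s),
  inord (find (fun z' => `[< ball z' n.+1%:R^-1 a.2 >]) (cs n)))).
exists (fun n (ij : 'I_(size s).+1 * 'I_(size (cs n)).+1) =>
  nth 0 (map (u (nth b0 s ij.1)) (cs n)) ij.2).
move=> U /nbhs0_disked[W [W0 dW WU]].
(* Here [z'] ranges over all points near [z], since points of the net may lie outside [K]. *)
have unif b : b \in s -> \forall n \near \oo, K `<=` fun z =>
    forall z', ball z' n.+1%:R^-1 z -> W (u b z - u b z').
  move=> bs; have /compact_near_coveringP := K_compact; apply=> x Kx.
  have := u_continuous bs (nbhs0_shift (u b x) (nbhs0_scale 2 W0)).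
  move=> /nbhs_ballP[e /= e0' eW].
  have e20 : 0 < e / 2 by rewrite divr_gt0.
  exists (ball x (e / 2), [set n | n.+1%:R^-1 < e / 2]).
    split; first exact: nbhsx_ballx.
    exact: (near_infty_natSinv_lt (PosNum e20)).
  move=> [z n] [/= xz ne] z' z'z.
  have xz' : ball x e z'.
    by apply: ball_split xz _; apply: ball_sym; apply: (le_ball _ z'z); exact: ltW.
  have {}xz : ball x e z by apply: (le_ball _ xz); lra.
  have -> : u b z - u b z' =
      2^-1 *: (2 *: (u b z - u b x)) + (- 2^-1) *: (2 *: (u b z' - u b x)).
    by rewrite !scalerA mulNr mulVf// scale1r scaleN1r opprB addrA subrK.
  by apply: dW; [exact: eW|exact: eW|rewrite normrN gtr0_norm; lra].
apply: filterS (near_all_seq _ unif) => n nW b z bs Kz; apply: WU => /=.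
have [z' z'cs z'z] := csP n z Kz.
set p := (fun z' => _); have hasp : has p (cs n).
  by apply/hasP; exists z' => //; exact/asboolP.
rewrite !inordK ?ltnS ?index_size ?find_size// nth_index//.
rewrite (nth_map z'); last by rewrite -has_find.
by apply: nW => //; apply/asboolP; exact: (nth_find z' hasp).
Qed.

End Compactness.

(** Bounded sets in a finite power of the line are totally bounded: after a shift by [B], values are
    rounded down to multiples of [e]. Finitely many codes arise, and points with equal codes are
    [e]-close. *)
Lemma finite_net (R : realType) (T : Type) (Q : set T) (q0 : T) (I : finType)
    (phi : T -> I -> R) (B e : R) : Q q0 -> 0 < e ->
  (forall q i, Q q -> `|phi q i| <= B) ->
  exists (J : finType) (p : J -> T), (forall j, Q (p j)) /\
    forall q, Q q -> exists j, forall i, `|phi q i - phi (p j) i| <= e.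
Proof.
move=> Qq0 e0 phiB.
pose y q i := (phi q i + B) / e.
have y0 q i : Q q -> 0 <= y q i.
  move=> /(phiB _ i); rewrite ler_norml => /andP[h _].
  by rewrite divr_ge0 ?(ltW e0)//; lra.
pose M := Num.truncn (2 * B / e).
have yM q i : Q q -> (Num.truncn (y q i) <= M)%N.
  move=> Qq; apply: le_truncn; rewrite ler_pM2r ?invr_gt0//.
  by have := phiB _ i Qq; rewrite ler_norml => /andP[_ h]; lra.
pose code q : {ffun I -> 'I_M.+1} := [ffun i => inord (Num.truncn (y q i))].
(* Each code that occurs gets a representative in [Q]; the others get [q0]. *)
have /choice[p pP] : forall j : {ffun I -> 'I_M.+1}, exists t,
    Q t /\ ((exists2 q, Q q & code q = j) -> code t = j).
  move=> j; have [[q Qq qj]|nj] := pselect (exists2 q, Q q & code q = j).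
    by exists q.
  by exists q0.
exists {ffun I -> 'I_M.+1}, p; split=> [j|q Qq]; first exact: (pP j).1.
have Qp := (pP (code q)).1; exists (code q) => i.
have pq : code (p (code q)) = code q by apply: (pP (code q)).2; exists q.
have {}pq : Num.truncn (y (p (code q)) i) = Num.truncn (y q i).
  have := congr1 (fun c : {ffun I -> 'I_M.+1} => val (c i)) pq.
  by rewrite !ffunE /= !inordK// ltnS; apply: yM.
have := truncn_itv (y0 q i Qq); have := truncn_itv (y0 _ i Qp).
rewrite pq -natr1; move: (Num.truncn _)%:R => t /andP[h1 h2] /andP[h3 h4].
have -> : phi q i - phi (p (code q)) i = e * (y q i - y (p (code q)) i).
  by rewrite /y; field; rewrite gt_eqF.
rewrite normrM gtr0_norm// ler_piMr ?(ltW e0)// ler_norml.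
by apply/andP; split; lra.
Qed.

(** * The vector-valued extension *)

Section WholeSpace.
Context {R : realType} {d : nat} {l : option nat} {F : lcsType R}.

Lemma setT_dense_interior : [set: 'rV[R]_d] `<=` closure [set: 'rV[R]_d]°.
Proof. by rewrite interiorT closureT. Qed.

Lemma to_setT_continuous : continuous (@to_setT 'rV[R]_d).
Proof. by apply: continuous_comp_initial => x; exact: cvg_id. Qed.

Lemma val_continuous (D : set 'rV[R]_d) : continuous (val : D -> 'rV[R]_d).
Proof. exact: initial_continuous. Qed.

Lemma Cl_setT_mpderiv (u : Cl l [set: 'rV[R]_d] F) a x : ord_le (mindex_size a) l ->
  Cl_mpderiv a u (to_setT x) = mpderiv a ('valL_0 u) x.
Proof. by move=> al; rewrite (Cl_mpderivP u al).2 ?interiorT. Qed.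

Lemma Cl_setT_Cl_on (u : Cl l [set: 'rV[R]_d] F) : Cl_on l setT ('valL_0 u).
Proof. by have [_ + _] := is_Cl_Cl u; rewrite interiorT. Qed.

Lemma is_Cl_setT (f : 'rV[R]_d -> F) : Cl_on l setT f ->
  is_Cl l (fun x : [set: 'rV[R]_d] => f (val x)) /\
  forall a, ord_le (mindex_size a) l ->
    is_mpderiv_ext a (fun x : [set: 'rV[R]_d] => f (val x)) (mpderiv a f \o val).
Proof.
move=> Cf; set g := (fun x : [set: _] => f (val x)).
have gE : {in (setT : set 'rV[R]_d), f =1 'valL_0 g}.
  by move=> x _; rewrite -[x in RHS]/(val (to_setT x)) valL_val.
have cfa a (al : ord_le (mindex_size a) l) :
    continuous (mpderiv a f \o (val : [set: 'rV[R]_d] -> _)).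
  by move=> x; apply: continuous_comp; [exact: val_continuous|exact: Cf.2].
have ext a : ord_le (mindex_size a) l -> is_mpderiv_ext a g (mpderiv a f \o val).
  move=> al; split=> [|x _]; first exact: cfa.
  by rewrite /= (eq_on_mpderiv a openT gE) ?inE.
split=> //; split; last by move=> a al; exists (mpderiv a f \o val); exact: ext.
  pose z : {ffun 'I_d -> nat} := [ffun=> 0%N].
  have z0 : mindex_size z = 0%N by apply: big1 => i _; rewrite ffunE.
  by have := cfa z; rewrite z0 mindex_size_eq0//; apply; case: l.
by rewrite interiorT; exact: eq_on_Cl openT gE Cf.
Qed.

End WholeSpace.

Section VectorValuedExtension.
Context {R : realType} {d : nat} {l : option nat} {D : set 'rV[R]_d}.
Hypothesis D_dense : D `<=` closure D°.
Local Notation E := 'rV[R]_d.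
Variable ext : {linear Cl l D R^o -> Cl l [set: E] R^o}.
Hypothesis ext_continuous : continuous ext.
Implicit Types (a b : {ffun 'I_d -> nat}) (x : E).

Definition ext_mpderiv a x (f : Cl l D R^o) : R^o := mpderiv a ('valL_0 (ext f)) x.

Lemma ext_mpderiv_linear a x : ord_le (mindex_size a) l -> linear (ext_mpderiv a x).
Proof.
move=> al c f g; rewrite /ext_mpderiv -!Cl_setT_mpderiv// linearP.
by rewrite Cl_mpderiv_lin//; exact: setT_dense_interior.
Qed.

Lemma ext_mpderivB a x f g : ord_le (mindex_size a) l ->
  ext_mpderiv a x (f - g) = ext_mpderiv a x f - ext_mpderiv a x g.
Proof.
move=> al; have [t tE] := linear_bundle (ext_mpderiv_linear x al).
by rewrite -!tE linearB.
Qed.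

Lemma Cl_mpderivB b f g z : ord_le (mindex_size b) l ->
  Cl_mpderiv b (f - g : Cl l D R^o) z = Cl_mpderiv b f z - Cl_mpderiv b g z.
Proof.
move=> bl; have [j jE] := linear_bundle (Cl_mpderiv_linear (F := R^o) D_dense z bl).
by rewrite -[LHS]jE linearB !jE.
Qed.

(** The same [s], [K] and [C] serve for all [x] in [L]; this gives local uniformity in the
    continuity proofs. *)
Lemma ext_mpderiv_bound a (L : set E) : ord_le (mindex_size a) l -> compact L ->
  exists (s : seq {ffun 'I_d -> nat}) (K : set D) (C : R),
    [/\ forall b, b \in s -> ord_le (mindex_size b) l, compact K, 0 < C &
      forall (f : Cl l D R^o) (e : R), 0 < e ->
        (forall b z, b \in s -> K z -> `|Cl_mpderiv b f z : R| <= e) ->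
        forall x, L x -> `|ext_mpderiv a x f : R| <= C * e].
Proof.
move=> al cL; have cL' : compact (to_setT @` L).
  apply: continuous_compact => //; apply: continuous_subspaceT.
  exact: to_setT_continuous.
have [s [K [C [ls cK C0 bnd]]]] :=
  Cl_linear_bound D_dense setT_dense_interior ext_continuous al cL'.
exists s, K, C; split=> // f e e0 fe x Lx.
have := bnd (e^-1 *: f) _ (to_setT x) (imageP _ Lx).
have [t tE] := linear_bundle (ext_mpderiv_linear x al).
rewrite Cl_setT_mpderiv// -[mpderiv _ _ _]/(ext_mpderiv a x _) -!tE.
have -> : t (e^-1 *: f) = e^-1 * t f by rewrite linearZ.
rewrite normrM gtr0_norm ?invr_gt0// ler_pdivrMl// mulrC; apply=> b z bs Kz.
have [j jE] := linear_bundle (Cl_mpderiv_linear (F := R^o) D_dense z (ls _ bs)).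
rewrite -[Cl_mpderiv _ _ _]jE; have -> : j (e^-1 *: f) = e^-1 * j f by rewrite linearZ.
by rewrite normrM gtr0_norm ?invr_gt0// ler_pdivrMl// mulr1 jE fe.
Qed.

Context {F : lcsType R}.
Hypothesis F_complete : sequentially_complete F.
Implicit Types (g : Cl l D F).

(** This is [weak_integral] for the functional [ext_mpderiv a x], dominated by the evaluations of
    the derivatives with index in [s] at points of [K]; the integrand is the jet of [g]. *)
Lemma weak_extension a x g : ord_le (mindex_size a) l ->
  exists y, forall (lam : {linear F -> R^o}) (clam : continuous lam),
    lam y = ext_mpderiv a x (Cl_comp clam g).
Proof.
move=> al.
have [s [K [C [ls cK C0 bnd]]]] := ext_mpderiv_bound al (@compact_set1 _ x).
pose S : set ({ffun 'I_d -> nat} * D) := [set p | p.1 \in s /\ K p.2].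
pose J (p : {ffun 'I_d -> nat} * D) (f : Cl l D R^o) : R := Cl_mpderiv p.1 f p.2.
have [t tE] := linear_bundle (ext_mpderiv_linear x al).
have u_cont b : b \in s -> continuous (Cl_mpderiv b g).
  by move=> bs; exact: (Cl_mpderivP g (ls _ bs)).1.
have [Ix [c [v vP]]] := compact_step_approximation cK [ffun=> 0%N] u_cont.
have J_linear p : S p -> linear (J p : _ -> R^o).
  by move=> [/ls pl _]; exact: Cl_mpderiv_linear.
have J_bounded f : exists M : R, forall p, S p -> `|J p f| <= M.
  (* Bounds are sought near infinity in order to combine those for the finitely many [b]. *)
  have /filter_ex[M MP] : \forall M \near +oo, forall b, b \in s ->
      forall z, K z -> `|Cl_mpderiv b f z : R| <= M.
    apply: near_all_seq => b /ls bl.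
    have [M MP] := compact_bounded_fun cK (Cl_mpderivP f bl).1.
    apply: filterS (nbhs_pinfty_ge (num_real M)) => N MN z Kz.
    exact: le_trans (MP z Kz) MN.
  by exists M => p [ps Kp]; exact: MP.
have T_bounded f : (forall p, S p -> `|J p f| <= 1) -> `|t f| <= C.
  move=> f1; rewrite tE -[leRHS]mulr1; apply: bnd => //.
  by move=> b z bs Kz; exact: (f1 (b, z)).
have [|W W0|y yP] := weak_integral C0 J_linear J_bounded T_bounded
    (Gam := fun p => Cl_mpderiv p.1 g p.2) F_complete _ (c := c) (v := v).
- move=> lam clam; exists (Cl_comp clam g) => p [/ls pl _].
  by rewrite /J Cl_comp_mpderiv.
- by apply: filterS (vP W W0) => n nW [b z] [bs Kz]; exact: nW.
exists y => lam clam; rewrite -tE; apply/esym/yP => // p [/ls pl _].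
by rewrite /J Cl_comp_mpderiv.
Qed.

(** The value is determined by the forms, by [eq_by_dual]; the default 0 is not reached when the
    order of [a] is at most [l]. Each [a] gets its own function, later identified as a derivative of
    the one of order 0. *)
Definition vext a g x : F := xget 0 [set y |
  forall (lam : {linear F -> R^o}) (clam : continuous lam),
    lam y = ext_mpderiv a x (Cl_comp clam g)].

Lemma vextP a g x (lam : {linear F -> R^o}) (clam : continuous lam) :
  ord_le (mindex_size a) l -> lam (vext a g x) = ext_mpderiv a x (Cl_comp clam g).
Proof.
move=> al; rewrite /vext; case: xgetP => [y _ ->//|no].
by have [y yP] := weak_extension x g al; case: (no y).
Qed.

(* Up to small errors only finitely many forms of the polar of W matter, since
   the jet of g on K is close to a step function with finitely many values. *)
Lemma vext_continuous a g : ord_le (mindex_size a) l -> continuous (vext a g).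
Proof.
move=> al x U /nbhs_shift0/nbhs0_disked[W [W0 dW WU]].
(* A compact neighbourhood of [x], so that one estimate for [ext] holds at all nearby points. *)
pose L := [set y : E | `|x - y| <= 1].
have cL : compact L.
  apply: bounded_closed_compact.
    exists (`|x| + 1); split=> [|M ltM y /= xy]; first exact: num_real.
    rewrite -[y](subKr x); apply: le_trans (ler_normB _ _) _.
    by apply: le_trans (ltW ltM); rewrite lerD2l.
  by rewrite -[L](closed_ballE x ltr01); exact: closed_ball_closed.
have Lx : nbhs x L.
  by apply/nbhs_ballP; exists 1 => //= y; rewrite -ball_normE => /ltW.
have [s [K [C [ls cK C0 bnd]]]] := ext_mpderiv_bound al cL.
(* Three errors of size [e] will add up: the step approximation seen by two forms, and the distance
   of these forms on the finitely many values. *)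
pose e := (12 * C)^-1; have e0 : 0 < e by rewrite invr_gt0 mulr_gt0.
have Ce : C * (3 * e) = 4^-1 by rewrite /e; field; rewrite gt_eqF.
have u_cont b : b \in s -> continuous (Cl_mpderiv b g).
  by move=> bs; exact: (Cl_mpderivP g (ls _ bs)).1.
have [Ix [c [v vP]]] := compact_step_approximation cK [ffun=> 0%N] u_cont.
have [n nW] := filter_ex (vP _ (nbhs0_scale e^-1 W0)).
pose Q := [set lam : {linear F -> R^o} | continuous lam /\ polar W lam].
pose phi (lam : {linear F -> R^o}) i : R := lam (v n i).
have [B phiB] : exists B, forall lam i, Q lam -> `|phi lam i| <= B.
  have /choice[r rP] : forall i, exists r : R, 0 < r /\ W (r^-1 *: v n i).
    move=> i; have [r r0 Wr] := nbhs0_absorbing W0 (v n i).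
    by exists r^-1; rewrite invr_gt0 invrK.
  exists (\sum_i r i) => lam i [_ plam].
  apply: le_trans (polar_scale (rP i).1 plam (rP i).2) _.
  by rewrite (bigD1 i)//= lerDl sumr_ge0// => j _; rewrite ltW// (rP j).1.
have Q0 : Q \0.
  by split=> [z|z _ /=]; [exact: cvg_cst|rewrite normr0].
have [j [p [Qp pP]]] := finite_net Q0 e0 phiB.
(* Only the finitely many forms of the net need continuity of their scalar extensions at [x]. *)
have near_p : \forall x' \near x, forall i, i \in enum j ->
    `|ext_mpderiv a x' (Cl_comp (Qp i).1 g)
      - ext_mpderiv a x (Cl_comp (Qp i).1 g) : R| <= 4^-1.
  apply: (near_all_seq (nbhs_filter x)) => i _.
  have /cvgrPdist_le := (Cl_setT_Cl_on (ext (Cl_comp (Qp i).1 g))).2 a x al I.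
  by move=> /(_ 4^-1 ltac:(lra)); apply: filterS => x'; rewrite distrC.
have Lxx := nbhs_singleton Lx.
apply: filterS2 Lx near_p => x' Lx' px' /=.
rewrite -[vext a g x'](subrKC (vext a g x)); apply: WU.
apply: in_nbhs_polar => // lam clam plam.
have [i ip] := pP lam (conj clam plam).
have close y : L y -> `|ext_mpderiv a y (Cl_comp clam g)
    - ext_mpderiv a y (Cl_comp (Qp i).1 g) : R| <= 4^-1.
  move=> Ly; rewrite -ext_mpderivB// -Ce; apply: bnd => //; first by rewrite mulr_gt0.
  move=> b z bs Kz; rewrite Cl_mpderivB ?ls// !Cl_comp_mpderiv ?ls//=.
  have := ip (c n (b, z)); rewrite /phi.
  have := polar_scale e0 plam (nW b z bs Kz).
  have := polar_scale e0 (Qp i).2 (nW b z bs Kz).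
  rewrite !linearB/=; set p1 : R := p i _; set p2 : R := p i _.
  set l1 : R := lam _; set l2 : R := lam _; rewrite !ler_norml.
  by move=> /andP[? ?] /andP[? ?] /andP[? ?]; apply/andP; split; lra.
rewrite linearB/= !(vextP _ _ clam)//.
have := close _ Lx'; have := close x Lxx; have := px' i (mem_enum _ _).
set w' : R := ext_mpderiv a x' (Cl_comp (Qp i).1 g).
set w : R := ext_mpderiv a x (Cl_comp (Qp i).1 g).
set u' : R := ext_mpderiv a x' _; set u : R := ext_mpderiv a x _.
(* Three errors of at most 1/4 stay below 1. *)
rewrite !ler_norml ltr_norml => /andP[? ?] /andP[? ?] /andP[? ?].
by apply/andP; split; lra.
Qed.

(** Composed with a form, this is [pderiv_mpderiv] for a scalar extension; [weak_pderiv] then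
    removes the form. *)
Lemma vext_is_pderiv a i g x : ord_le (mindex_size a).+1 l ->
  is_pderiv i (vext a g) x (vext (mindex_incr a i) g x).
Proof.
move=> al; have il : ord_le (mindex_size (mindex_incr a i)) l.
  by rewrite mindex_size_incr.
apply: weak_pderiv; first exact: vext_continuous.
move=> lam clam z; rewrite (vextP _ _ clam)//.
have Ce := Cl_setT_Cl_on (ext (Cl_comp clam g)).
have -> : lam \o vext a g = mpderiv a ('valL_0 (ext (Cl_comp clam g))).
  by apply/funext => y; rewrite /= (vextP _ _ clam)//; exact: ord_leS.
rewrite /ext_mpderiv -(pderiv_mpderiv i Ce al).
by apply: pderivP; exact: Ce.1.
Qed.

Let zero : {ffun 'I_d -> nat} := [ffun=> 0%N].

Lemma vext_mpderiv a g : ord_le (mindex_size a) l ->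
  mpderiv a (vext zero g) = vext a g.
Proof.
move an : (mindex_size a) => n; elim: n a an => [|n IH] a an al.
  rewrite mindex_size_eq0//; congr (vext _ g); apply/ffunP => i.
  rewrite ffunE; apply/esym/eqP; move/eqP: an.
  by rewrite sum_nat_eq0 => /forallP/(_ i).
have [k [ak aE]] := mpderiv_split R (a := a) ltac:(by rewrite an).
have bn : mindex_size (mindex_decr a k) = n.
  by apply: succn_inj; rewrite -mindex_size_decr.
rewrite aE (IH _ bn (ord_leS al)); apply/funext => x; apply: is_pderivE.
have := @vext_is_pderiv (mindex_decr a k) k g x.
by rewrite mindex_decrK// bn; apply.
Qed.

Lemma vext_Cl_on g : Cl_on l setT (vext zero g).
Proof.
split=> [a i|a] x al _; last by rewrite vext_mpderiv//; exact: vext_continuous.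
rewrite vext_mpderiv; last exact: ord_leS.
by exists (vext (mindex_incr a i) g x); exact: vext_is_pderiv.
Qed.

Lemma Cl_vext_subproof g :
  (fun x : [set: E] => vext zero g (val x)) \in @Cl_pred R d l [set: E] F.
Proof. exact/asboolP/(is_Cl_setT (vext_Cl_on g)).1. Qed.

Definition Cl_vext g : Cl l [set: E] F := MkCl (Cl_vext_subproof g).

Lemma Cl_vext_mpderiv a g : ord_le (mindex_size a) l ->
  Cl_mpderiv a (Cl_vext g) = vext a g \o val.
Proof.
move=> al; apply: (Cl_mpderivE setT_dense_interior).
by rewrite -vext_mpderiv//; exact: (is_Cl_setT (vext_Cl_on g)).2.
Qed.

Lemma zero_ord : ord_le (mindex_size zero) l.
Proof.
have -> : mindex_size zero = 0%N by apply: big1 => i _; rewrite ffunE.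
by case: l.
Qed.

Lemma Cl_comp_lin (lam : {linear F -> R^o}) (clam : continuous lam) (k : R) g h :
  Cl_comp clam (k *: g + h) = k *: Cl_comp clam g + Cl_comp clam h.
Proof. by apply/val_inj/funext => z; rewrite /= linearP. Qed.

Lemma Cl_vext_linear : linear Cl_vext.
Proof.
move=> k g h; apply/val_inj/funext => z.
rewrite -[RHS]/(k *: vext zero g (val z) + vext zero h (val z)) /=.
apply: eq_by_dual => lam clam; rewrite linearP/= !(vextP _ _ clam) ?zero_ord//.
by rewrite Cl_comp_lin ext_mpderiv_linear//; exact: zero_ord.
Qed.

(** If the jets of [g] and [g0] differ on [K] by elements of [e W], every form in the polar of [W]
    sees a difference of at most [e], and the bound for [ext] applies uniformly in the form. *)
Lemma Cl_vext_continuous : continuous Cl_vext.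
Proof.
move=> g0; apply: (Cl_cvgP (Cl_vext g0) (fmap_filter _ (nbhs_filter g0))).2.
move=> a al L U cL /nbhs0_disked[W [W0 dW WU]].
have cL' : compact (val @` L).
  by apply: continuous_compact => //; apply: continuous_subspaceT; exact: val_continuous.
have [s [K [C [ls cK C0 bnd]]]] := ext_mpderiv_bound al cL'.
pose e := (2 * C)^-1; have e0 : 0 < e by rewrite invr_gt0 mulr_gt0.
have Ce : C * e = 2^-1 by rewrite /e; field; rewrite gt_eqF.
have /Cl_cvgP near_g0 : nbhs g0 --> g0 by exact: cvg_id.
have : \forall g \near g0, forall b, b \in s -> forall z, K z ->
    W (e^-1 *: (Cl_mpderiv b g z - Cl_mpderiv b g0 z)).
  apply: (near_all_seq (nbhs_filter g0)) => b /ls bl.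
  exact: near_g0 b bl K _ cK (nbhs0_scale e^-1 W0).
apply: filterS => g gW z Lz /=; apply: WU; rewrite !Cl_vext_mpderiv//=.
apply: in_nbhs_polar => // lam clam plam.
rewrite linearB/= !(vextP _ _ clam)// -ext_mpderivB//.
suff : `|ext_mpderiv a (val z) (Cl_comp clam g - Cl_comp clam g0) : R| <= C * e.
  by rewrite Ce => le2; apply: le_lt_trans le2 _; lra.
apply: bnd => // b y bs Ky.
rewrite Cl_mpderivB ?ls// !Cl_comp_mpderiv ?ls//= -linearB.
by apply: polar_scale plam _ => //; exact: gW.
Qed.

Lemma Cl_vextK : cancel ext (@Cl_restr R d l D R^o) ->
  cancel Cl_vext (@Cl_restr R d l D F).
Proof.
move=> extK g; apply/val_inj/funext => z.
rewrite -[LHS]/(vext zero g (val z)).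
apply: eq_by_dual => lam clam; rewrite (vextP _ _ clam) ?zero_ord//.
(* At order 0 the functional is evaluation of the scalar extension, which restricts to the
   composition of [lam] with [g]. *)
rewrite /ext_mpderiv mindex_size_eq0; last by apply: big1 => i _; rewrite ffunE.
rewrite -[X in 'valL_0 _ X]/(val (to_setT (val z))) valL_val.
by have := congr1 (fun f : Cl l D R^o => f z) (extK (Cl_comp clam g)).
Qed.

End VectorValuedExtension.

Theorem theorem1p3 (R : realType) (d : nat) (l : option nat)
    (D : set 'rV[R]_d) (d_gt0 : (0 < d)%N)
    (D_closed : closed D) (D_convex : convex_set D)
    (D_dense_interior : D `<=` closure D°)
    (scalar_case : continuous_linear_right_inverse (@Cl_restr R d l D R^o)) :
  forall F : lcsType R, sequentially_complete F ->
    continuous_linear_right_inverse (@Cl_restr R d l D F).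
Proof.
move=> F F_complete; have [ext [cext extK]] := scalar_case.
have [e eE] := linear_bundle (Cl_vext_linear D_dense_interior cext F_complete).
exists e; rewrite (funext eE).
by split; [exact: Cl_vext_continuous|exact: Cl_vextK].
Qed.
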